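(* Consider the switched oscillator hybrid system $\mathcal{H}_{\varepsilon,\eta_1}$ defined in the context, with frequencies $w_1,\dots,w_r\in\mathbb{Q}_{>0}$ satisfying $w_i\neq w_j$ for all $i\neq j$, and suppose that each graph $\mathcal{G}_k$, $k\in\{1,\dots,N_2\}$, is connected and undirected. Then there is an open set $\mathcal{B}_{\mathcal{A}}\supset\mathcal{A}$ such that $\mathcal{H}_{\varepsilon,\eta_1}$ renders the set $$\mathcal{A}=\{x\in\mathbb{T}^r:\ x^1=x^2=\dots=x^r\}\times C_z$$ semi-globally practically asymptotically stable (SGPAS) as $(\varepsilon,\eta_1)\to0^+$ with basin of attraction $\mathcal{B}_{\mathcal{A}}$.
   Context: **Hybrid systems.** A hybrid dynamical system (HDS) with data $(C,F,D,G)$ is written $y\in C,\ \dot y\in F(y)$; $y\in D,\ y^+\in G(y)$, with $F,G$ set-valued. A compact hybrid time domain is a set $E=\bigcup_{j=0}^{J-1}([t_j,t_{j+1}],j)\subset\mathbb{R}_{\ge0}\times\mathbb{Z}_{\ge0}$ for a finite sequence $0=t_0\le t_1\le\dots\le t_J$; $E$ is a hybrid time domain if $E\cap([0,T]\times\{0,\dots,J\})$ is a compact hybrid time domain for all $(T,J)\in E$. A solution is a function $y$ on a hybrid time domain $\mathrm{dom}(y)$, with $y(\cdot,j)$ locally absolutely continuous for each $j$ for which $I_j=\{t:(t,j)\in\mathrm{dom}(y)\}$ has nonempty interior, such that $y(0,0)\in C\cup D$; for each such $j$, $y(t,j)\in C$ for all $t\in I_j$ and $\dot y(t,j)\in F(y(t,j))$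 for almost all $t\in I_j$; and whenever $(t,j),(t,j+1)\in\mathrm{dom}(y)$, $y(t,j)\in D$ and $y(t,j+1)\in G(y(t,j))$. **Oscillators.** Let $r\ge2$, $\mathbb{S}^1\subset\mathbb{R}^2$ the unit circle, $\mathbb{T}^r=\mathbb{S}^1\times\dots\times\mathbb{S}^1\subset\mathbb{R}^{2r}$, $x=(x^1,\dots,x^r)\in\mathbb{T}^r$, $S=\begin{pmatrix}0&1\\-1&0\end{pmatrix}$. Let $\mathcal{J}\subseteq\{+1,-1\}^r$ be a set of control directions with $|\mathcal{J}|=N_1\ge1$, and $\mathcal{G}_1,\dots,\mathcal{G}_{N_2}$ ($N_2\ge1$) graphs $\mathcal{G}_k=(\mathcal{V},\mathcal{E}_k)$ on $\mathcal{V}=\{1,\dots,r\}$, with neighbor sets $\mathcal{N}^i_k=\{j\in\mathcal{V}:(i,j)\in\mathcal{E}_k\}$. Let $\mathcal{Q}=\{1,\dots,N_1N_2\}$, with $N_1N_2\ge2$, and fix a bijection $\mathcal{Q}\ni z_1\mapsto(k(z_1),\alpha(z_1))\in\{1,\dots,N_2\}\times\mathcal{J}$. For $\kappa>0$ put $$J_{i,k}(x)=\tfrac12\sum_{j\in\mathcal{N}^i_k}|x^i-x^j|^2,\qquad u_{i,k}(x,\tau_2)=\varepsilon^{-1}\sqrt{2w_i}\,\cos\big(w_i\tau_2+\kappa J_{i,k}(x)\big)\kappa^{-1/2}.$$ **The hybrid system $\mathcal{H}_{\varepsilon,\eta_1}$.** Fix $\eta_2\in[0,1)$, $N_\circ\ge1$,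 $T_\circ>0$ (arbitrary); let $\varepsilon>0,\eta_1>0$. State $(x,z,\tau)$ with $z=(z_1,z_2,z_3)$, $\tau=(\tau_1,\tau_2)\in\mathbb{R}^2_{\ge0}$. Set $C_z=\mathcal{Q}\times[0,N_\circ]\times[0,T_\circ]$, $D_z=\mathcal{Q}\times[1,N_\circ]\times[0,T_\circ]$. For $(x,z)\in\mathbb{T}^r\times C_z$, $\tau\in\mathbb{R}^2_{\ge0}$ the flow is $$\dot x^i=\big(1+\alpha_i(z_1)\,u_{i,k(z_1)}(x,\tau_2)\big)Sx^i\ (i=1,\dots,r),\quad \dot z\in\{0\}\times[0,\eta_1]\times[0,\eta_2],\quad \dot\tau_1=\varepsilon^{-1},\ \dot\tau_2=\varepsilon^{-2}.$$ For $(x,z)\in\mathbb{T}^r\times D_z$, $\tau\in\mathbb{R}^2_{\ge0}$ the jump is $x^+=x$, $z^+\in(\mathcal{Q}\setminus\{z_1\})\times\{z_2-1\}\times\{z_3\}$, $\tau^+=\tau$. Write $\theta=(x,z)$. **Stability notions.** $\beta:\mathbb{R}_{\ge0}\times\mathbb{R}_{\ge0}\to\mathbb{R}_{\ge0}$ is of class $\mathcal{KL}$ if it is nondecreasing in its first argument, nonincreasing in its second, $\lim_{r\to0^+}\beta(r,s)=0$ for each $s$ and $\lim_{s\to\infty}\beta(r,s)=0$ for each $r$. For a compact set $\mathcal{A}$ contained in an open set $\mathcal{B}_{\mathcal{A}}$, $\omega:\mathcal{B}_{\mathcal{A}}\to\mathbb{R}_{\ge0}$ is a proper indicator for $\mathcal{A}$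 on $\mathcal{B}_{\mathcal{A}}$ if it is continuous, vanishes exactly on $\mathcal{A}$, and $\{\omega(y_i)\}$ is unbounded whenever $\{y_i\}\subset\mathcal{B}_{\mathcal{A}}$ approaches the boundary of $\mathcal{B}_{\mathcal{A}}$ or is unbounded. $\mathcal{A}$ is SGPAS as $(\varepsilon,\eta_1)\to0^+$ with basin of attraction $\mathcal{B}_{\mathcal{A}}$ (parameters tuned sequentially, starting with $\eta_1$) if for each proper indicator $\omega$ for $\mathcal{A}$ on $\mathcal{B}_{\mathcal{A}}$ there is $\beta\in\mathcal{KL}$ such that for each compact $K\subset\mathcal{B}_{\mathcal{A}}$ and each $\nu>0$ there is $\eta_1^*>0$ such that for each $\eta_1\in(0,\eta_1^*]$ there is $\varepsilon^*>0$ such that for all $\varepsilon\in(0,\varepsilon^*]$ every solution with $\theta(0,0)\in K$ satisfies $\omega(\theta(t,j))\le\beta(\omega(\theta(0,0)),t+j)+\nu$ for all $(t,j)$ in its domain. *)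

(* Defs.v *)
From HB Require Import structures.
From mathcomp Require Import all_boot all_order all_algebra.
From mathcomp Require Import all_classical all_reals all_analysis.

Set Implicit Arguments.
Unset Strict Implicit.
Unset Printing Implicit Defensive.

Import Order.TTheory GRing.Theory Num.Theory.
Import numFieldNormedType.Exports.

Local Open Scope classical_set_scope.
Local Open Scope ring_scope.

(* Hybrid systems are stated over an arbitrary normed module; they are used
   below with a product of spaces of real matrices and reals, whose (sup) norm
   is equivalent to the Euclidean one. *)

Record hybrid_system (R : realType) (V : normedModType R) := HybridSystem {
  flow_set : set V;
  flow_map : V -> set V;
  jump_set : set V;
  jump_map : V -> set V
}.

Definition compact_hybrid_time_domain (R : realType) (E : set (R * nat)) :=
  exists (J : nat) (t : nat -> R),
    [/\ t 0%N = 0,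
        (forall j, (j < J)%N -> t j <= t j.+1) &
        E = [set p | (p.2 < J)%N /\ t p.2 <= p.1 <= t p.2.+1]].

Definition hybrid_time_domain (R : realType) (E : set (R * nat)) :=
  (forall p, E p -> 0 <= p.1) /\
  forall p, E p -> compact_hybrid_time_domain
    (E `&` [set q | 0 <= q.1 <= p.1 /\ (q.2 <= p.2)%N]).

Definition time_slice (R : realType) (E : set (R * nat)) (j : nat) : set R :=
  [set t | E (t, j)].

Definition absolutely_continuous (R : realType) (V : normedModType R)
    (f : R -> V) (a b : R) :=
  forall e : R, 0 < e -> exists2 d : R, 0 < d &
    forall (n : nat) (s t : 'I_n -> R),
      (forall k, [/\ a <= s k, s k <= t k & t k <= b]) ->
      (forall k l, k != l -> t k <= s l \/ t l <= s k) ->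
      \sum_(k < n) (t k - s k) < d ->
      \sum_(k < n) `|f (t k) - f (s k)| < e.

Definition locally_absolutely_continuous (R : realType) (V : normedModType R)
    (f : R -> V) (I : set R) :=
  forall a b : R, a <= b -> `[a, b]%classic `<=` I ->
    absolutely_continuous f a b.

(* A solution is a total function together with its domain E; its values
   outside E are irrelevant.  The two-sided derivative below only depends on
   the values on the interval I_j at interior points of I_j, and the endpoints
   are Lebesgue-negligible. *)
Definition is_solution (R : realType) (V : normedModType R)
    (H : hybrid_system V) (E : set (R * nat)) (y : R -> nat -> V) :=
  [/\ hybrid_time_domain E,
      E (0, 0%N),
      (flow_set H `|` jump_set H) (y 0 0%N),
      (forall j, (time_slice E j)° !=set0 ->
        [/\ locally_absolutely_continuous (fun t => y t j) (time_slice E j),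
            (forall t, time_slice E j t -> flow_set H (y t j)) &
            {ae lebesgue_measure, forall t : R, time_slice E j t ->
               exists2 v, flow_map H (y t j) v &
                          is_derive t (1 : R) (fun s => y s j) v}]) &
      (forall t j, E (t, j) -> E (t, j.+1) ->
        jump_set H (y t j) /\ jump_map H (y t j) (y t j.+1))].

Definition class_KL (R : realType) (beta : R -> R -> R) :=
  [/\ (forall a s : R, 0 <= a -> 0 <= s -> 0 <= beta a s),
      (forall a b s : R, 0 <= a -> a <= b -> 0 <= s -> beta a s <= beta b s),
      (forall a s t : R, 0 <= a -> 0 <= s -> s <= t -> beta a t <= beta a s),
      (forall s : R, 0 <= s -> beta a s @[a --> 0^'+] --> (0 : R)) &
      (forall a : R, 0 <= a -> beta a s @[s --> +oo] --> (0 : R))].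

(* omega is a total function of which only the values on B matter. *)
Definition proper_indicator (R : realType) (W : normedModType R)
    (A B : set W) (omega : W -> R) :=
  [/\ {within B, continuous omega},
      (forall p, B p -> 0 <= omega p),
      (forall p, B p -> (omega p = 0 <-> A p)) &
      (forall p : nat -> W, (forall n, B (p n)) ->
        (forall e : R, 0 < e ->
           \forall n \near \oo,
             exists2 b, (closure B `\` B°) b & `|p n - b| < e) \/
        ~ bounded_set (range p) ->
        ~ bounded_set (range (omega \o p)))].

(* H eta1 eps is the system with parameters eta1 and eps, and theta extracts
   the part of the state whose stability is considered.  As omega is only
   defined on B, the bound includes that the solution does not leave B. *)
Definition SGPAS (R : realType) (V W : normedModType R) (theta : V -> W)
    (H : R -> R -> hybrid_system V) (A B : set W) :=
  [/\ compact A, open B, A `<=` B &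
    forall omega : W -> R, proper_indicator A B omega ->
    exists2 beta : R -> R -> R, class_KL beta &
    forall K : set W, compact K -> K `<=` B ->
    forall nu : R, 0 < nu ->
    exists2 eta1s : R, 0 < eta1s &
    forall eta1 : R, 0 < eta1 <= eta1s ->
    exists2 epss : R, 0 < epss &
    forall eps : R, 0 < eps <= epss ->
    forall (E : set (R * nat)) (y : R -> nat -> V),
      is_solution (H eta1 eps) E y -> K (theta (y 0 0%N)) ->
      forall t j, E (t, j) ->
        B (theta (y t j)) /\
        omega (theta (y t j)) <=
          beta (omega (theta (y 0 0%N))) (t + j%:R) + nu].

(* The points of R^2r are the r x 2 matrices whose i-th row is x^i; z and tau
   are the tuples (z_1, z_2, z_3) and (tau_1, tau_2). *)
Notation osc_space R r := ('M[R]_(r, 2)).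
Notation aux_space R := (R * R * R)%type.
Notation osc_state R r := ('M[R]_(r, 2) * (R * R * R) * (R * R))%type.

Definition osc (R : realType) (r : nat) (x : osc_space R r) (i : 'I_r) :
  'cV[R]_2 := (row i x)^T.

(* The norm of the library on matrices is the sup norm, not the Euclidean. *)
Definition euclid_sq (R : realType) (v : 'cV[R]_2) : R :=
  \sum_(c < 2) v c 0 ^+ 2.

Definition torus (R : realType) (r : nat) : set (osc_space R r) :=
  [set x | forall i, euclid_sq (osc x i) = 1].

Definition sync_set (R : realType) (r : nat) : set (osc_space R r) :=
  [set x | torus x /\ forall i j, osc x i = osc x j].

Definition rotation_S (R : realType) : 'M[R]_2 := block_mx (0 : 'M[R]_1) 1 (- 1) (0 : 'M[R]_1).

(* q : 'I_n stands for the mode q + 1 in {1, ..., n}. *)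
Definition mode_value (R : realType) (n : nat) (q : 'I_n) : R := q.+1%:R.

Definition mode_set (R : realType) (n : nat) : set R :=
  range (@mode_value R n).

Definition Cz (R : realType) (n : nat) (N0 T0 : R) : set (aux_space R) :=
  [set z | [/\ mode_set n z.1.1, 0 <= z.1.2 <= N0 & 0 <= z.2 <= T0]].

Definition Dz (R : realType) (n : nat) (N0 T0 : R) : set (aux_space R) :=
  [set z | [/\ mode_set n z.1.1, 1 <= z.1.2 <= N0 & 0 <= z.2 <= T0]].

(* A vector of {+1, -1}^r is encoded by booleans, b standing for (-1)^b. *)
Notation direction r := ({ffun 'I_r -> bool}).

Definition sign_of (R : realType) (r : nat) (alpha : direction r) (i : 'I_r) :
  R := (-1) ^+ alpha i.

Definition cost (R : realType) (r : nat) (G : rel 'I_r) (x : osc_space R r)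
    (i : 'I_r) : R :=
  2^-1 * \sum_(j < r | G i j) euclid_sq (osc x i - osc x j).

Definition control (R : realType) (r : nat) (w : 'I_r -> R) (kappa : R)
    (G : rel 'I_r) (eps : R) (x : osc_space R r) (tau2 : R) (i : 'I_r) : R :=
  eps^-1 * Num.sqrt (2 * w i) * cos (w i * tau2 + kappa * cost G x i)
    * (Num.sqrt kappa)^-1.

Definition osc_flow_map (R : realType) (r n N2 : nat) (w : 'I_r -> R)
    (kappa : R) (G : 'I_N2 -> rel 'I_r) (mode : 'I_n -> 'I_N2 * direction r)
    (eta2 eta1 eps : R) (s : osc_state R r) : set (osc_state R r) :=
  let: (x, (z1, z2, z3), (tau1, tau2)) := s in
  [set v | let: (dx, (dz1, dz2, dz3), (dtau1, dtau2)) := v in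
    [/\ exists2 q : 'I_n, z1 = mode_value R q &
          forall i, osc dx i =
            (1 + sign_of R (mode q).2 i *
                 control w kappa (G (mode q).1) eps x tau2 i)
            *: (rotation_S R *m osc x i),
        [/\ dz1 = 0, 0 <= dz2 <= eta1 & 0 <= dz3 <= eta2],
        dtau1 = eps^-1 &
        dtau2 = eps ^- 2]].

Definition osc_jump_map (R : realType) (r n : nat) (s : osc_state R r) :
    set (osc_state R r) :=
  let: (x, (z1, z2, z3), tau) := s in
  [set s' | let: (x', (z1', z2', z3'), tau') := s' in
    [/\ x' = x,
        (mode_set n `\ z1) z1' /\ z2' = z2 - 1 /\ z3' = z3 &
        tau' = tau]].

Definition switched_oscillators (R : realType) (r n N2 : nat) (w : 'I_r -> R)
    (kappa : R) (G : 'I_N2 -> rel 'I_r) (mode : 'I_n -> 'I_N2 * direction r)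
    (eta2 N0 T0 eta1 eps : R) : hybrid_system (osc_state R r) :=
  HybridSystem
    [set s : osc_state R r |
      [/\ torus s.1.1, Cz n N0 T0 s.1.2, 0 <= s.2.1 & 0 <= s.2.2]]
    (osc_flow_map w kappa G mode eta2 eta1 eps)
    [set s : osc_state R r |
      [/\ torus s.1.1, Dz n N0 T0 s.1.2, 0 <= s.2.1 & 0 <= s.2.2]]
    (@osc_jump_map R r n).

(* Main.v *)
(* Averaging with an explicit Lyapunov function. Let [V] be half the sum of
   all [|x^i - x^j|^2]. Along a flow, [V' = eps^-2 V_tau + eps^-1 L1 V + L0 V],
   where [L1] differentiates along the oscillating control and [L0] along the
   common rotation, which leaves [V] invariant. Correctors [P1], [P2] are chosen
   with [L1 V + d/dtau P1 = 0] and [L1 P1 + d/dtau P2 = - D]: as the frequencies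
   are distinct, the only resonant terms are the squares [cos^2], and they leave
   the averaged dissipation [D = sum_l (d_l V) (d_l J_l)].  On the torus
   [D = sum_(i ~ j) (1 - x^i.x^j) sum_m (x^i.x^m + x^j.x^m)], which on [V < 1],
   where all inner products are positive, dominates [c V] by connectedness, for
   every graph. Hence [W = V + eps P1 + eps^2 P2] satisfies [W' <= - c V + O(eps)]
   on [V < 1] in all modes; adding [2 M eps z_2] makes it nonincreasing at the
   jumps, because [z_2] drops by one there. So [V <= exp (- c t) V_0 + C eps],
   while [z_2 >= 0] bounds the number of jumps by [N0 + t] when [eta1 <= 1]. The
   basin is [V < 1], and compactness of the torus turns the decay of [V] into a
   class KL bound for an arbitrary proper indicator. *)
Require Import Defs.
From HB Require Import structures.
From mathcomp Require Import all_boot all_order all_algebra.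
From mathcomp Require Import all_classical all_reals all_analysis.
From mathcomp Require Import ring lra.

Import Order.TTheory GRing.Theory Num.Theory.
Import numFieldNormedType.Exports.

Local Open Scope classical_set_scope.
Local Open Scope ring_scope.

Set Implicit Arguments.
Unset Strict Implicit.
Unset Printing Implicit Defensive.

(** * Absolutely continuous functions *)

Section AbsoluteContinuity.
Variable R : realType.
Implicit Types (f : R -> R) (U : set R) (l : seq (R * R)).

(** Sorted lists of closed intervals replace finite families indexed by ordinals, so that the
    intervals found on adjacent pieces of [[a, b]] are joined by plain concatenation. *)
Fixpoint chain U (u v : R) l : Prop :=
  if l is p :: l' then
    [/\ u <= p.1, p.1 <= p.2, `[p.1, p.2]%classic `<=` U & chain U p.2 v l']
  else u <= v.

Lemma chain_cat U u v w l1 l2 :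
  chain U u v l1 -> chain U v w l2 -> chain U u w (l1 ++ l2).
Proof.
elim: l1 u => [|p l1 IH] u /=.
  case: l2 => [|q l2] /= uv; first exact: le_trans.
  by move=> [vq ? ? ?]; split => //; exact: le_trans vq.
by move=> [? ? ? c1] c2; split => //; exact: IH c2.
Qed.

Lemma chain_le U u v l : chain U u v l -> u <= v.
Proof.
elim: l u => [//|p l IH] u /= [up pp _ /IH]; apply: le_trans.
exact: le_trans pp.
Qed.

Lemma chain_nth U u v l : chain U u v l -> forall i, (i < size l)%N ->
  [/\ u <= (nth (0, 0) l i).1, (nth (0, 0) l i).1 <= (nth (0, 0) l i).2
    & (nth (0, 0) l i).2 <= v].
Proof.
elim: l u => [//|p l IH] u /= [up pp _ c] [_|i] /=.
  by split => //; exact: chain_le c.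
rewrite ltnS => /(IH _ c)[a b d]; split => //.
by apply: le_trans a; exact: le_trans pp.
Qed.

Lemma chain_sep U u v l : chain U u v l ->
  forall i j, (i < j)%N -> (j < size l)%N ->
    (nth (0, 0) l i).2 <= (nth (0, 0) l j).1.
Proof.
elim: l u => [//|p l IH] u /= [up pp _ c] [|i] [|j] //=.
  by rewrite ltnS => _ jl; have [] := chain_nth c jl.
by rewrite !ltnS; exact: IH c i j.
Qed.

(** The increments of [F] over the intervals of the chain telescope; the gaps between them cost
    nothing because [F] is monotone. *)
Lemma chain_length U u v l (F : R -> R) : {homo F : x y / x <= y} ->
  (forall s t, s <= t -> `[s, t]%classic `<=` U -> t - s <= F t - F s) ->
  chain U u v l -> \sum_(p <- l) (p.2 - p.1) <= F v - F u.
Proof.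
move=> Fmono FU; elim: l u => [|p l IH] u /=.
  by move=> uv; rewrite big_nil subr_ge0 Fmono.
move=> [up pp pU /IH c]; rewrite big_cons.
have := FU _ _ pp pU; have := Fmono _ _ up; lra.
Qed.

Lemma chain_variation f a b e : absolutely_continuous f a b -> 0 < e ->
  exists2 d : R, 0 < d & forall U u v l, chain U u v l -> a <= u -> v <= b ->
    \sum_(p <- l) (p.2 - p.1) < d ->
    \sum_(p <- l) `|f p.2 - f p.1| < e.
Proof.
move=> fac e0; have [d0 d00 Hd] := fac e e0; exists d0 => // U u v l c au vb.
rewrite (big_nth (0, 0)) [X in _ -> X < _](big_nth (0, 0)) !big_mkord => sl.
apply: Hd => //.
- by move=> k; have [] := chain_nth c (ltn_ord k) => ? ? ?; split => //; lra.
- move=> k m km; have [km'|mk] := ltnP k m.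
    by left; exact: (chain_sep c).
  right; apply: (chain_sep c) => //.
  by rewrite ltn_neqAle mk andbT eq_sym; exact: km.
Qed.

Lemma open_negligible (N : set R) (e : R) : lebesgue_measure.-negligible N ->
  0 < e -> exists U, [/\ open U, N `<=` U & (lebesgue_measure U < e%:E)%E].
Proof.
move=> [D [mD D0 ND]] e0.
have [|U [oU DU UD]] := @lebesgue_regularity_outer R D e mD _ e0.
  by rewrite [X in (X < _)%E]D0.
exists U; split => //; first exact: subset_trans DU.
apply: le_lt_trans UD; rewrite -[leRHS]adde0 -D0.
rewrite -measureU//; first by rewrite setUC setDUK.
  by apply: measurableD => //; exact: measurable_realfun.open_measurable.
by rewrite setDE -setIA [X in _ `&` X]setIC setICr setI0.
Qed.

Section content.
Variables (U : set R) (a e : R).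
Hypotheses (oU : open U) (Ue : (lebesgue_measure U < e%:E)%E).

Let F x := fine (lebesgue_measure (U `&` `]a, x]%classic)).

Let mUx x : measurable (U `&` `]a, x]%classic).
Proof. by apply: measurableI => //; exact: measurable_realfun.open_measurable. Qed.

Let F_fin x : lebesgue_measure (U `&` `]a, x]%classic) \is a fin_num.
Proof.
rewrite ge0_fin_numE//; apply: (@lt_trans _ _ e%:E); last exact: ltry.
apply: le_lt_trans Ue.
apply: le_measure; rewrite ?inE; [exact: mUx|exact: measurable_realfun.open_measurable|].
exact: subIsetl.
Qed.

(** The witness is the measure of [U] intersected with []a, x]]. As a monotone function of [x] it
    feeds [chain_length], so the total length of a chain inside [U] is below [e]. *)
Lemma open_content : exists F : R -> R,
  [/\ {homo F : x y / x <= y}, (forall x, 0 <= F x), (forall x, F x < e) &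
   forall s t, a <= s -> s <= t -> `[s, t]%classic `<=` U ->
     t - s <= F t - F s].
Proof.
exists F; split.
- move=> x y xy; apply: fine_le; rewrite ?F_fin//.
  apply: le_measure; rewrite ?inE; [exact: mUx|exact: mUx|].
  by apply: setIS => z /=; rewrite !in_itv/= => /andP[-> /le_trans]; exact.
- by move=> x; exact: fine_ge0.
- move=> x; rewrite -lte_fin fineK ?F_fin//; apply: le_lt_trans Ue.
  apply: le_measure; rewrite ?inE; [exact: mUx|exact: measurable_realfun.open_measurable|].
  exact: subIsetl.
- move=> s t as_ st stU; rewrite lerBrDr -lee_fin EFinD !fineK ?F_fin//.
  have -> : (t - s)%:E = lebesgue_measure `]s, t]%classic.
    rewrite lebesgue_measure_itv/= lte_fin; case: ltP => // ts.
    by rewrite (_ : t - s = 0)//; lra.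
  rewrite -measureU//; [|exact: mUx|]; last first.
    apply/seteqP; split => // x [] /=; rewrite !in_itv/= => /andP[sx _].
    by move=> [_ /andP[_]]; rewrite leNgt sx.
  apply: le_measure; rewrite ?inE.
  + by apply: measurableU; [exact: measurable_itv|exact: mUx].
  + exact: mUx.
  + move=> x [|[Ux]] /=; rewrite !in_itv/= => /andP[h1 h2]; split.
    * by apply: stU => /=; rewrite in_itv/= (ltW h1).
    * by rewrite h2 (le_lt_trans as_ h1).
    * by [].
    * by rewrite h1 (le_trans h2 st).
Qed.
End content.

(** Cousin's lemma as an induction principle, without tagged partitions. Let [c] be the supremum of
    the points reachable from [a]. The local hypothesis at [c] links a reachable point just below
    [c] to a point beyond it, unless [c = b]. *)
Lemma cousin_induction (P : R -> R -> Prop) (a b : R) : a <= b ->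
  (forall u v w, P u v -> P v w -> P u w) ->
  (forall x, a <= x <= b -> exists2 d : R, 0 < d & forall u v,
     a <= u -> u <= x -> x <= v -> v <= b -> x - u < d -> v - x < d -> P u v) ->
  P a b.
Proof.
move=> ab Ptrans Ploc.
pose S := [set x | a <= x <= b /\ P a x].
have Sa : S a.
  split; first by rewrite lexx.
  have [|d d0] := Ploc a; first by rewrite lexx.
  by apply; rewrite ?subrr.
have Sb : ubound S b by move=> x [/andP[]].
have hS : has_sup S by split; [exists a|exists b].
pose c := sup S.
have ac : a <= c by apply: ub_le_sup Sa; exists b.
have cb : c <= b by apply: ge_sup => //; exists a.
have [|d d0 Pd] := Ploc c; first by rewrite ac.
have [x Sx cx] := sup_adherent d0 hS.
have xc : x <= c by apply: ub_le_sup Sx; exists b.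
have [/andP[ax xb] Pax] := Sx.
pose v := Num.min b (c + d / 2).
have vb : v <= b by rewrite ge_min lexx.
have cv : c <= v by rewrite le_min cb/= lerDl ltW// divr_gt0.
have Pav : P a v.
  apply: Ptrans Pax _; apply: Pd => //; first by rewrite -/c in cx; lra.
  have : v <= c + d / 2 by rewrite ge_min lexx orbT.
  lra.
have vc : v <= c.
  apply: ub_le_sup; first by exists b.
  by split => //; rewrite vb (le_trans ac).
have vE : v = b.
  move: vc; rewrite /v minElt; case: ltP => // _; lra.
by rewrite -vE.
Qed.

Lemma derivative_le (f : R -> R) (t d e : R) : is_derive t (1 : R) f d ->
  0 < e -> exists2 d0 : R, 0 < d0 & forall h : R, `|h| < d0 ->
    `|f (t + h) - f t - h * d| <= e * `|h|.
Proof.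
move=> [df dfE] e0; move: df; rewrite /derivable => /cvg_ex[/= l lP].
have dl : d = l by rewrite -dfE; apply/cvg_lim.
move: lP => /cvgrPdist_le lP; have {lP} := lP _ e0.
rewrite near_withinE => /nbhs_ballP[d0 /= d00 dP]; exists d0 => // h hd.
have [->|h0] := eqVneq h 0; first by rewrite addr0 subrr mul0r subr0 !normr0 mulr0.
have /= := dP h; rewrite /ball/= sub0r normrN => /(_ hd h0).
rewrite !scaler1/= [h + t]addrC => H.
have -> : f (t + h) - f t - h * d = - h * (l - h^-1 * (f (t + h) - f t)).
  by rewrite dl; field.
by rewrite normrM normrN mulrC ler_wpM2r.
Qed.

(** Cover the exceptional null set by an open set of small measure. Small intervals around an
    exceptional point lie in this open set, and absolute continuity bounds their total contribution.
    Around any other point the derivative is nonpositive, so [f] gains at most [e] times the length.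
    Cousin induction combines the two kinds of intervals. *)
Lemma ac_nonincreasing f a b : a <= b -> absolutely_continuous f a b ->
  {ae lebesgue_measure, forall t : R, a < t < b ->
     exists2 d, d <= 0 & is_derive t (1 : R) f d} ->
  f b <= f a.
Proof.
move=> ab fac fd; apply/ler_addgt0Pr => e0 e00.
(* Chosen so that [e * (b - a) + e = e0]: one share for the regular intervals, one for the
   exceptional ones. *)
pose e := e0 / (b - a + 1).
have ba0 : 0 < b - a + 1 by lra.
have e_gt0 : 0 < e by rewrite divr_gt0.
have [d d0 dP] := chain_variation fac e_gt0.
(* The endpoints count as exceptional, because the derivative is controlled only strictly inside the
   interval. *)
pose N :=
  (~` [set t | a < t < b -> exists2 d, d <= 0 & is_derive t (1 : R) f d]) `|`
  [set a] `|` [set b].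
have N0 : lebesgue_measure.-negligible N.
  apply: negligibleU; first apply: negligibleU => //.
  - by apply/negligibleP => //; exact: lebesgue_measure_set1.
  - by apply/negligibleP => //; exact: lebesgue_measure_set1.
have [U [oU NU Ud]] := open_negligible N0 d0.
have [F [Fmono F0 Fd FU]] := open_content a oU Ud.
(* The list [l] collects the intervals around exceptional points. They are kept to the right of [a],
   where the content [F] measures length. *)
pose P u v := exists l, [/\ a <= u -> chain (U `&` [set x | a <= x]) u v l
  & f v - f u <= e * (v - u) + \sum_(p <- l) `|f p.2 - f p.1|] /\ u <= v.
suff [l [[/(_ (lexx a)) c fl] _]] : P a b.
  have := dP _ _ _ _ c (lexx a) (lexx b).
  have : \sum_(p <- l) (p.2 - p.1) <= F b - F a.
    apply: chain_length c => // s t st stU; apply: FU => //.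
      by have [] := stU s; rewrite //= in_itv/= lexx.
    by move=> x /stU[].
  have := Fd b; have := F0 a => ? ? ? /(_ _).
  have -> : f b <= f a + e0 <-> f b - f a <= e * (b - a) + e.
    have -> : e * (b - a) + e = e0 by rewrite /e; field; rewrite gt_eqF.
    by split; lra.
  move=> H; have {}H := H ltac:(lra); lra.
apply: cousin_induction => //.
- move=> u v w [l1 [[c1 f1] uv]] [l2 [[c2 f2] vw]].
  exists (l1 ++ l2); split; last exact: le_trans vw; split.
    move=> au; apply: chain_cat (c1 au) (c2 _); exact: le_trans uv.
  by rewrite big_cat/=; lra.
- move=> x /andP[ax xb]; have [Nx|Nx] := pselect (N x).
    have [d1 /= d10 xU] := (nbhs_ballP x U).1 (open_nbhs_nbhs (conj oU (NU _ Nx))).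
    exists d1 => // u v au ux xv vb xu vx; exists [:: (u, v)]; split; last first.
      exact: le_trans xv.
    rewrite big_seq1/=; split => [_|]; last first.
      have : 0 <= e * (v - u) by apply: mulr_ge0; [exact: ltW|lra].
      have := ler_norm (f v - f u); lra.
    split => //; first exact: le_trans xv.
    move=> y /=; rewrite in_itv/= => /andP[uy yv]; split; last exact: le_trans uy.
    apply: xU; rewrite /ball/= ltr_distl; apply/andP; split; lra.
  have axb : a < x < b.
    rewrite !lt_neqAle ax xb !andbT; apply/andP; split; apply/eqP => xE; apply: Nx.
      by left; right.
    by right.
  have [D D0 fD] : exists2 d, d <= 0 & is_derive x (1 : R) f d.
    by apply: contrapT => H; apply: Nx; left; left => /= /(_ axb).
  have [d1 d10 Hd] := derivative_le fD e_gt0.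
  exists d1 => // u v au ux xv vb xu vx; exists [::]; split; last exact: le_trans xv.
  split; first by move=> _ /=; exact: le_trans xv.
  rewrite big_nil addr0.
  have := Hd (v - x); rewrite ger0_norm ?subr_ge0// => /(_ vx).
  rewrite subrKC => /(le_trans (ler_norm _)) H1.
  have := Hd (u - x); rewrite distrC ger0_norm ?subr_ge0// => /(_ xu).
  rewrite subrKC ler_norml => /andP[H2 _].
  have : (v - x) * D <= 0 by apply: mulr_ge0_le0 => //; lra.
  have : 0 <= (u - x) * D by apply: mulr_le0 => //; lra.
  lra.
Qed.

End AbsoluteContinuity.

(** * Gronwall inequalities for absolutely continuous functions *)

Section Comparison.
Variable R : realType.
Implicit Types (f Y V : R -> R).

Lemma ae_imply (P Q : R -> Prop) : (forall t, P t -> Q t) ->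
  {ae lebesgue_measure, forall t : R, P t} ->
  {ae lebesgue_measure, forall t : R, Q t}.
Proof. by move=> PQ; apply: negligibleS; apply: subsetC => t; exact: PQ. Qed.

Lemma ac_sub (W : normedModType R) (g : R -> W) (a b a' b' : R) :
  a <= a' -> b' <= b -> absolutely_continuous g a b ->
  absolutely_continuous g a' b'.
Proof.
move=> aa bb gac e e0; have [d d0 H] := gac e e0; exists d => // n s t st.
by apply: H => k; have [? ? ?] := st k; split => //; lra.
Qed.

(** The summand [t - s] admits functions that depend on time explicitly, such as an exponential
    factor or a linear term, besides the dominating curve [g]. *)
Lemma ac_dominated (W : normedModType R) (g : R -> W) f (a b K : R) :
  absolutely_continuous g a b ->
  (forall s t, a <= s -> s <= t -> t <= b ->
     `|f t - f s| <= K * (`|g t - g s| + (t - s))) ->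
  absolutely_continuous f a b.
Proof.
move=> gac fg e e0; pose K' := Num.max K 1.
have K1 : 1 <= K' by rewrite le_max lexx orbT.
have K0 : 0 < K' by lra.
have e'0 : 0 < e / (2 * K') by rewrite divr_gt0// mulr_gt0.
have [d d0 dP] := gac _ e'0.
exists (Num.min d (e / (2 * K'))) => [|n s t st sep]; first by rewrite lt_min d0.
rewrite lt_min => /andP[sd se]; have := dP n s t st sep sd => sg.
have : \sum_(k < n) `|f (t k) - f (s k)| <=
    \sum_(k < n) K' * (`|g (t k) - g (s k)| + (t k - s k)).
  apply: ler_sum => k _; have [h1 h2 h3] := st k.
  apply: le_trans (fg _ _ h1 h2 h3) _; rewrite ler_wpM2r//.
    by rewrite addr_ge0// subr_ge0.
  by rewrite le_max lexx.
rewrite -mulr_sumr big_split/= => /le_lt_trans; apply.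
have -> : e = K' * (e / (2 * K') + e / (2 * K')) by field; rewrite gt_eqF.
by rewrite ltr_pM2l//; lra.
Qed.

Lemma ac_increment f (a b e : R) : absolutely_continuous f a b -> 0 < e ->
  exists2 d : R, 0 < d & forall s t, a <= s -> s <= t -> t <= b -> t - s < d ->
    `|f t - f s| < e.
Proof.
move=> fac e0; have [d d0 H] := fac e e0; exists d => // s t as_ st tb std.
have := H 1%N (fun=> s) (fun=> t); rewrite !big_ord1; apply => //.
by move=> k l; rewrite !ord1 eqxx.
Qed.

Lemma expR_increment (c b s t : R) : 0 <= c -> s <= t -> t <= b ->
  `|expR (c * t) - expR (c * s)| <= c * expR (c * b) * (t - s).
Proof.
move=> c0 st tb.
have E x : is_derive x (1 : R) (fun u => expR (c * u)) (c * expR (c * x)).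
  apply: is_derive_eq; rewrite /GRing.scale/=; ring.
have [|z zst ->] := @MVT_segment R (fun u => expR (c * u))
    (fun u => c * expR (c * u)) s t st (fun x _ => E x).
  apply: derivable_within_continuous => x _.
  by case: (E x).
rewrite ger0_norm; last by rewrite !mulr_ge0 ?expR_ge0 ?subr_ge0.
rewrite ler_wpM2r ?subr_ge0// ler_wpM2l// ler_expR ler_wpM2l//.
by move: zst; rewrite in_itv/= => /andP[_ /le_trans]; exact.
Qed.

(** The integrating factor makes [expR (c * t) * (Y t - m)] nonincreasing. The bound [B] serves to
    show that this product is absolutely continuous. *)
Lemma ac_gronwall Y (a b c m B : R) : a <= b -> 0 < c ->
  absolutely_continuous Y a b -> (forall t, a <= t <= b -> `|Y t| <= B) ->
  {ae lebesgue_measure, forall t : R, a < t < b ->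
     exists2 d, d <= - c * (Y t - m) & is_derive t (1 : R) Y d} ->
  Y b - m <= expR (- c * (b - a)) * (Y a - m).
Proof.
move=> ab c0 Yac YB Yd.
have B0 : 0 <= B by apply: le_trans (YB a _); rewrite ?lexx.
pose u t := expR (c * t) * (Y t - m).
have uac : absolutely_continuous u a b.
  apply: (@ac_dominated _ Y _ _ _
    (expR (c * b) + (B + `|m|) * (c * expR (c * b)))) => // s t as_ st tb.
  have -> : u t - u s = expR (c * t) * (Y t - Y s)
      + (Y s - m) * (expR (c * t) - expR (c * s)) by rewrite /u; ring.
  apply: le_trans (ler_normD _ _) _; rewrite !normrM.
  have E0 : 0 <= expR (c * b) by exact: expR_ge0.
  have h1 : `|expR (c * t)| * `|Y t - Y s| <= expR (c * b) * `|Y t - Y s|.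
    by rewrite ger0_norm ?expR_ge0// ler_wpM2r// ler_expR ler_wpM2l// ltW.
  have h2 : `|Y s - m| * `|expR (c * t) - expR (c * s)| <=
      (B + `|m|) * (c * expR (c * b) * (t - s)).
    apply: ler_pM => //; last by apply: expR_increment => //; exact: ltW.
    apply: le_trans (ler_normB _ _) _; rewrite lerD2r YB// as_/=.
    exact: le_trans tb.
  apply: le_trans (lerD h1 h2) _.
  have h3 : 0 <= expR (c * b) * (t - s) by rewrite mulr_ge0// subr_ge0.
  have h4 : 0 <= (B + `|m|) * (c * expR (c * b)) * `|Y t - Y s|.
    by rewrite !mulr_ge0 ?addr_ge0// ltW.
  rewrite mulrDl !mulrDr; lra.
have : u b <= u a.
  apply: ac_nonincreasing => //.
  apply: ae_imply Yd => t H /H[d dY YD].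
  exists (expR (c * t) * (d + c * (Y t - m))).
    by apply: mulr_ge0_le0; [exact: expR_ge0|lra].
  apply: is_derive_eq; rewrite /GRing.scale/= /cst; ring.
rewrite /u => H.
have -> : expR (- c * (b - a)) = expR (c * a) / expR (c * b).
  by rewrite -expRN -expRD; congr expR; ring.
rewrite mulrAC ler_pdivlMr ?expR_gt0// mulrC; exact: H.
Qed.

(** The differential inequality is available only below the barrier [V < h]. Up to the first time
    [V] reaches [h], Gronwall keeps [Y] below the larger of [Y a] and [m], hence below [h]; since
    [V <= Y], that time cannot exist. *)
Lemma ac_gronwall_barrier V Y (a b c m B h : R) : a <= b -> 0 < c ->
  absolutely_continuous V a b -> absolutely_continuous Y a b ->
  (forall t, a <= t <= b -> `|Y t| <= B) ->
  (forall t, a <= t <= b -> V t <= Y t) -> Y a < h -> m < h ->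
  {ae lebesgue_measure, forall t : R, a < t < b -> V t < h ->
     exists2 d, d <= - c * (Y t - m) & is_derive t (1 : R) Y d} ->
  Y b - m <= expR (- c * (b - a)) * (Y a - m).
Proof.
move=> ab c0 Vac Yac YB VY Yah mh Yd.
have upto i : a <= i -> i <= b -> (forall t, a < t < i -> V t < h) ->
    Y i - m <= expR (- c * (i - a)) * (Y a - m).
  move=> ai ib Vh; apply: (@ac_gronwall _ _ _ _ _ B) => //.
  - exact: ac_sub Yac.
  - by move=> t /andP[at_ ti]; apply: YB; rewrite at_ (le_trans ti).
  - apply: ae_imply Yd => t H ati; apply: H; last exact: Vh.
    by move: ati => /andP[-> /lt_le_trans]; exact.
have [[t [tab tV]]|noS] := pselect (exists t, a <= t <= b /\ h <= V t); last first.
  apply: upto => // t /andP[at_ tb]; rewrite ltNge; apply/negP => tV.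
  by apply: noS; exists t; split=> //; rewrite !ltW.
exfalso; pose S := [set t | a <= t <= b /\ h <= V t].
have Slb : lbound S a by move=> x [/andP[]].
have hS : has_inf S by split; [exists t|exists a].
(* The first hitting time of the barrier; continuity of [V] gives [h <= V i]. *)
pose i := inf S.
have ai : a <= i by apply: lb_le_inf => //; exists t.
have it : i <= t by apply: ge_inf; [exists a|split].
have ib : i <= b by apply: le_trans it _; case/andP: tab.
have Vi : h <= V i.
  rewrite leNgt; apply/negP => Vi.
  have [|d d0 dP] := ac_increment Vac (_ : 0 < h - V i); first by rewrite subr_gt0.
  have [s [/andP[as_ sb] sV] si] := inf_adherent d0 hS.
  have is_ : i <= s by apply: ge_inf; [exists a|split; rewrite ?as_].
  have := dP i s ai is_ sb; rewrite -/i in si.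
  move=> /(_ ltac:(lra)) /ltr_normlW; lra.
have Vlt x : a < x < i -> V x < h.
  move=> /andP[ax xi]; rewrite ltNge; apply/negP => xV.
  have : i <= x.
    apply: ge_inf; [exists a|split => //] => //.
    by rewrite (ltW ax)/= (le_trans (ltW xi)).
  lra.
have Yi := upto i ai ib Vlt; have VYi : V i <= Y i by apply: VY; rewrite ai.
have e1 : expR (- c * (i - a)) <= 1.
  by rewrite -expR0 ler_expR mulNr oppr_le0 mulr_ge0 ?subr_ge0// ltW.
have e0 := expR_ge0 (- c * (i - a)).
have [Yam|Yam] := leP m (Y a).
  have : expR (- c * (i - a)) * (Y a - m) <= Y a - m.
    by rewrite -[leRHS]mul1r ler_wpM2r// subr_ge0.
  lra.
have : expR (- c * (i - a)) * (Y a - m) <= 0 by apply: mulr_ge0_le0 => //; lra.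
lra.
Qed.

End Comparison.

(** * Trigonometric terms and their derivatives *)

Section TrigonometricTerms.
Variables (R : realType) (r : nat).
Local Notation space := 'M[R]_(r, 2).

(** A syntax for functions of the state and of [tau]. Derivatives, bounds and Lipschitz constants of
    the correctors are then obtained by recursion and proved correct once for all expressions. *)
Inductive term :=
  | Coord of 'I_r & 'I_2
  | Const of R
  | Add of term & term
  | Mul of term & term
  | Sum of ('I_r -> term)
  | Sin of R & term
  | Cos of R & term.

Fixpoint eval (x : space) (tau : R) (e : term) : R :=
  match e with
  | Coord i c => x i c
  | Const a => a
  | Add e1 e2 => eval x tau e1 + eval x tau e2
  | Mul e1 e2 => eval x tau e1 * eval x tau e2
  | Sum f => \sum_i eval x tau (f i)
  | Sin om e1 => sin (om * tau + eval x tau e1)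
  | Cos om e1 => cos (om * tau + eval x tau e1)
  end.

(* Derivative along the rotation of the l-th oscillator, [x^l |-> S x^l]. *)
Fixpoint deriv_rot (l : 'I_r) (e : term) : term :=
  match e with
  | Coord i c => if i == l then
      (if c == 0 then Coord i 1 else Mul (Const (-1)) (Coord i 0)) else Const 0
  | Const a => Const 0
  | Add e1 e2 => Add (deriv_rot l e1) (deriv_rot l e2)
  | Mul e1 e2 => Add (Mul (deriv_rot l e1) e2) (Mul e1 (deriv_rot l e2))
  | Sum f => Sum (fun i => deriv_rot l (f i))
  | Sin om e1 => Mul (deriv_rot l e1) (Cos om e1)
  | Cos om e1 => Mul (Mul (Const (-1)) (deriv_rot l e1)) (Sin om e1)
  end.

Fixpoint deriv_tau (e : term) : term :=
  match e with
  | Coord i c => Const 0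
  | Const a => Const 0
  | Add e1 e2 => Add (deriv_tau e1) (deriv_tau e2)
  | Mul e1 e2 => Add (Mul (deriv_tau e1) e2) (Mul e1 (deriv_tau e2))
  | Sum f => Sum (fun i => deriv_tau (f i))
  | Sin om e1 => Mul (Add (Const om) (deriv_tau e1)) (Cos om e1)
  | Cos om e1 => Mul (Mul (Const (-1)) (Add (Const om) (deriv_tau e1))) (Sin om e1)
  end.

Fixpoint tau_free (e : term) : Prop :=
  match e with
  | Coord _ _ | Const _ => True
  | Add e1 e2 | Mul e1 e2 => tau_free e1 /\ tau_free e2
  | Sum f => forall i, tau_free (f i)
  | Sin _ _ | Cos _ _ => False
  end.

Lemma tau_free_deriv_rot l e : tau_free e -> tau_free (deriv_rot l e).
Proof.
elim: e => //= [i c _|e1 IH1 e2 IH2 [/IH1 h1 /IH2 h2]|e1 IH1 e2 IH2 [t1 t2]|f IH h i].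
- by case: (i == l) => //; case: (c == 0).
- by split.
- by split; split => //; [exact: IH1|exact: IH2].
- exact: IH.
Qed.

Lemma eval_deriv_tau0 x tau e : tau_free e -> eval x tau (deriv_tau e) = 0.
Proof.
elim: e => //= [e1 IH1 e2 IH2 [/IH1 -> /IH2 ->]|e1 IH1 e2 IH2 [/IH1 -> /IH2 ->]|f IH h].
- by rewrite addr0.
- by rewrite mul0r mulr0 addr0.
- by rewrite big1// => i _; exact: IH.
Qed.

(** Valid for states in [unit_box], which contains the torus, and uniform in [tau], because [tau]
    enters only through sines and cosines. *)
Fixpoint bound (e : term) : R :=
  match e with
  | Coord _ _ => 1
  | Const a => `|a|
  | Add e1 e2 => bound e1 + bound e2
  | Mul e1 e2 => bound e1 * bound e2
  | Sum f => \sum_i bound (f i)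
  | Sin _ _ | Cos _ _ => 1
  end.

Fixpoint lip (e : term) : R :=
  match e with
  | Coord _ _ => 1
  | Const a => 0
  | Add e1 e2 => lip e1 + lip e2
  | Mul e1 e2 => lip e1 * bound e2 + bound e1 * lip e2
  | Sum f => \sum_i lip (f i)
  | Sin om e1 | Cos om e1 => `|om| + lip e1
  end.

Definition unit_box : set space := [set x | forall i c, `|x i c| <= 1].

Lemma bound_ge0 e : 0 <= bound e.
Proof.
by elim: e => //= *; [exact: addr_ge0|exact: mulr_ge0|exact: sumr_ge0].
Qed.

Lemma lip_ge0 e : 0 <= lip e.
Proof.
elim: e => //= *; rewrite ?addr_ge0 ?mulr_ge0 ?bound_ge0//.
exact: sumr_ge0.
Qed.

Lemma norm_sin_le1 (a : R) : `|sin a| <= 1.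
Proof. by rewrite ler_norml sin_geN1 sin_le1. Qed.

Lemma norm_cos_le1 (a : R) : `|cos a| <= 1.
Proof. by rewrite ler_norml cos_geN1 cos_le1. Qed.

Lemma eval_bound x tau e : unit_box x -> `|eval x tau e| <= bound e.
Proof.
move=> xB; elim: e => //= *.
- by apply: le_trans (ler_normD _ _) _; exact: lerD.
- by rewrite normrM ler_pM.
- by apply: le_trans (ler_norm_sum _ _ _) _; exact: ler_sum.
- exact: norm_sin_le1.
- exact: norm_cos_le1.
Qed.

Lemma lipschitz_of_derive (f df : R -> R) :
  (forall t, is_derive t (1 : R) f (df t)) -> (forall t, `|df t| <= 1) ->
  forall a b, `|f a - f b| <= `|a - b|.
Proof.
move=> fd fb; suff H a b : a <= b -> `|f a - f b| <= `|a - b|.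
  by move=> a b; have [/H//|/ltW/H] := leP a b; rewrite distrC (distrC b).
move=> ab; rewrite distrC (distrC a).
have [|z _ ->] := @MVT_segment R f df a b ab (fun t _ => fd t).
  by apply: derivable_within_continuous => t _; case: (fd t).
by rewrite normrM ler_piMl.
Qed.

Lemma sin_lipschitz (a b : R) : `|sin a - sin b| <= `|a - b|.
Proof. exact: (lipschitz_of_derive (@is_derive_sin R) norm_cos_le1). Qed.

Lemma cos_lipschitz (a b : R) : `|cos a - cos b| <= `|a - b|.
Proof.
apply: (lipschitz_of_derive (@is_derive_cos R)) => t.
by rewrite normrN norm_sin_le1.
Qed.

Lemma coord_norm (x : space) i c : `|x i c| <= `|x|.
Proof.
rewrite [leRHS]/Num.norm/= mx_normrE; apply/bigmax_geP; right.
by exists (i, c).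
Qed.

Lemma eval_lip x x' tau tau' e : unit_box x -> unit_box x' ->
  `|eval x tau e - eval x' tau' e| <= lip e * (`|x - x'| + `|tau - tau'|).
Proof.
move=> xB xB'; set d := `|x - x'| + _.
have d0 : 0 <= d by exact: addr_ge0.
have phase om f : `|eval x tau f - eval x' tau' f| <= lip f * d ->
    `|om * tau + eval x tau f - (om * tau' + eval x' tau' f)| <=
    (`|om| + lip f) * d.
  move=> IH.
  have -> : om * tau + eval x tau f - (om * tau' + eval x' tau' f) =
    om * (tau - tau') + (eval x tau f - eval x' tau' f) by ring.
  apply: le_trans (ler_normD _ _) _; rewrite mulrDl lerD// normrM ler_wpM2l//.
  by rewrite /d lerDr.
elim: e => /= [i c|a|e1 IH1 e2 IH2|e1 IH1 e2 IH2|f IH|om e IH|om e IH].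
- rewrite mul1r; have := coord_norm (x - x') i c; rewrite !mxE => /le_trans.
  by apply; rewrite lerDl.
- by rewrite subrr normr0 mul0r.
- rewrite opprD addrACA mulrDl; apply: le_trans (ler_normD _ _) _.
  exact: lerD.
- have -> : eval x tau e1 * eval x tau e2 - eval x' tau' e1 * eval x' tau' e2 =
    (eval x tau e1 - eval x' tau' e1) * eval x tau e2 +
    eval x' tau' e1 * (eval x tau e2 - eval x' tau' e2) by ring.
  apply: le_trans (ler_normD _ _) _; rewrite !normrM mulrDl lerD//.
    rewrite mulrAC; apply: ler_pM => //; exact: eval_bound.
  by rewrite -mulrA; apply: ler_pM => //; exact: eval_bound.
- rewrite -sumrB mulr_suml; apply: le_trans (ler_norm_sum _ _ _) _.
  by apply: ler_sum => i _; exact: IH.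
- exact: le_trans (sin_lipschitz _ _) (phase _ _ IH).
- exact: le_trans (cos_lipschitz _ _) (phase _ _ IH).
Qed.

Definition rot_coord (x : space) (i : 'I_r) (c : 'I_2) : R :=
  if c == 0 then x i 1 else - x i 0.

(** Along the system every oscillator rotates on its own circle at some speed [nu i], so the chain
    rule needs only the operators [deriv_rot l] and [deriv_tau]. *)
Lemma is_derive_eval (x : R -> space) (tau : R -> R) (t : R) (nu : 'I_r -> R)
    (sg : R) (e : term) :
  (forall i c, is_derive t (1 : R) (fun s => x s i c) (nu i * rot_coord (x t) i c)) ->
  is_derive t (1 : R) tau sg ->
  is_derive t (1 : R) (fun s => eval (x s) (tau s) e)
    (sg * eval (x t) (tau t) (deriv_tau e) +
     \sum_l nu l * eval (x t) (tau t) (deriv_rot l e)).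
Proof.
move=> xd taud; elim: e => /= [i c|a|e1 IH1 e2 IH2|e1 IH1 e2 IH2|f IH|om e IH|om e IH].
- apply: is_derive_eq; rewrite mulr0 add0r (bigD1 i)//= eqxx big1 ?addr0.
    by congr (_ * _); rewrite /rot_coord; case: (c == 0) => //=; rewrite mulN1r.
  by move=> l li; rewrite eq_sym (negbTE li) mulr0.
- apply: is_derive_eq; rewrite mulr0 add0r big1// => l _; exact: mulr0.
- apply: is_derive_eq.
  under [in RHS]eq_bigr do rewrite mulrDr.
  by rewrite big_split/=; ring.
- apply: is_derive_eq.
  under [in RHS]eq_bigr do rewrite mulrDr mulrA (mulrCA (nu _)).
  by rewrite big_split/= -mulr_suml -mulr_sumr /GRing.scale/=; ring.
- have -> : (fun s => \sum_i eval (x s) (tau s) (f i)) =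
      \sum_i (fun s => eval (x s) (tau s) (f i)).
    by apply/funext => s; rewrite fct_sumE.
  apply: is_derive_eq; rewrite big_split/= -mulr_sumr exchange_big/=.
  by congr (_ + _); apply: eq_bigr => l _; rewrite mulr_sumr.
- have H : is_derive t (1 : R) (fun s => om * tau s + eval (x s) (tau s) e)
    (om * sg + (sg * eval (x t) (tau t) (deriv_tau e) +
     \sum_l nu l * eval (x t) (tau t) (deriv_rot l e))).
    by apply: is_derive_eq; rewrite /GRing.scale/=; ring.
  apply: (is_derive_eq (is_derive1_comp (is_derive_sin _) H)).
  under [in RHS]eq_bigr do rewrite mulrA.
  by rewrite -mulr_suml; ring.
- have H : is_derive t (1 : R) (fun s => om * tau s + eval (x s) (tau s) e)
    (om * sg + (sg * eval (x t) (tau t) (deriv_tau e) +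
     \sum_l nu l * eval (x t) (tau t) (deriv_rot l e))).
    by apply: is_derive_eq; rewrite /GRing.scale/=; ring.
  apply: (is_derive_eq (is_derive1_comp (is_derive_cos _) H)).
  under [in RHS]eq_bigr do rewrite mulrA (mulrCA (nu _)) mulN1r.
  by rewrite -mulr_suml sumrN; ring.
Qed.

End TrigonometricTerms.

Arguments Coord {R r}.
Arguments Const {R r}.

(** * Dissipation of the averaged system *)

Section Oscillators.
Variables (R : realType) (r : nat).
Local Notation space := 'M[R]_(r, 2).
Local Notation term := (term R r).
Implicit Types (x : space) (G : rel 'I_r).

(** On the torus, [dot] and [wedge] are the cosine and the sine of the angle of oscillator [i] minus
    that of oscillator [j]. *)
Definition dot x i j : R := x i 0 * x j 0 + x i 1 * x j 1.
Definition wedge x i j : R := x i 1 * x j 0 - x i 0 * x j 1.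
Definition gap x i j : R := euclid_sq (osc x i - osc x j).
Definition disagreement x : R := 2^-1 * \sum_i \sum_j gap x i j.

Lemma gapE x i j : gap x i j = (x i 0 - x j 0) ^+ 2 + (x i 1 - x j 1) ^+ 2.
Proof.
rewrite /gap /euclid_sq big_ord_recl big_ord1 !mxE.
by congr (_ + (x _ _ - x _ _) ^+ 2); apply/val_inj.
Qed.

Lemma euclid_sq_osc x i : euclid_sq (osc x i) = dot x i i.
Proof.
rewrite /euclid_sq big_ord_recl big_ord1 !mxE /dot -!expr2.
by congr (_ + x _ _ ^+ 2); apply/val_inj.
Qed.

Lemma gap_ge0 x i j : 0 <= gap x i j.
Proof. by rewrite gapE addr_ge0 ?sqr_ge0. Qed.

Lemma gap_triangle x i j k : gap x i k <= 2 * gap x i j + 2 * gap x j k.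
Proof.
rewrite !gapE -subr_ge0.
have -> : 2 * ((x i 0 - x j 0) ^+ 2 + (x i 1 - x j 1) ^+ 2) +
    2 * ((x j 0 - x k 0) ^+ 2 + (x j 1 - x k 1) ^+ 2) -
    ((x i 0 - x k 0) ^+ 2 + (x i 1 - x k 1) ^+ 2) =
    (x i 0 + x k 0 - 2 * x j 0) ^+ 2 + (x i 1 + x k 1 - 2 * x j 1) ^+ 2 by ring.
by rewrite addr_ge0 ?sqr_ge0.
Qed.

Lemma gap_torus x i j : torus x -> gap x i j = 2 * (1 - dot x i j).
Proof.
move=> xT; have := xT i; have := xT j; rewrite !euclid_sq_osc gapE /dot => *.
by rewrite !expr2; lra.
Qed.

Lemma torus_unit_box x : torus x -> unit_box x.
Proof.
move=> xT i c; have := xT i; rewrite euclid_sq_osc /dot -!expr2 => xi.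
have H : x i c ^+ 2 <= 1.
  rewrite -xi; have [c0|c0] : c = 0 \/ c = 1.
    by case: c => [[|[|]]] //= ?; [left|right]; apply/val_inj.
  - by rewrite c0 lerDl sqr_ge0.
  - by rewrite c0 lerDr sqr_ge0.
by rewrite -(@ler_pXn2r _ 2)// ?nnegrE// expr1n real_normK// num_real.
Qed.

Lemma disagreement_ge0 x : 0 <= disagreement x.
Proof.
rewrite mulr_ge0 ?invr_ge0//; apply: sumr_ge0 => i _; apply: sumr_ge0 => j _.
exact: gap_ge0.
Qed.

Lemma gap_le_disagreement x i j : gap x i j <= 2 * disagreement x.
Proof.
rewrite /disagreement mulrA divff// mul1r (bigD1 i)//= (bigD1 j)//= -addrA lerDl.
rewrite addr_ge0//; apply: sumr_ge0 => k _; first exact: gap_ge0.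
by apply: sumr_ge0 => l _; exact: gap_ge0.
Qed.

Lemma rotation_entry (c d : 'I_2) : rotation_S R c d =
  if c == d then 0 else if c == 0 then 1 else -1.
Proof.
rewrite /rotation_S /block_mx !mxE.
by case: splitP => i; rewrite !mxE; case: splitP => j; rewrite !ord1/= => dE cE;
  rewrite !mxE -!(inj_eq val_inj)/= dE cE ?addn0 //=.
Qed.

Lemma rotation_osc x i c :
  (rotation_S R *m osc x i) c 0 = rot_coord x i c.
Proof.
rewrite !mxE big_ord_recl big_ord1 !rotation_entry !mxE /rot_coord.
have -> : lift ord0 ord0 = 1 :> 'I_2 by exact/val_inj.
have [->|->] : c = 0 \/ c = 1.
    by case: c => [[|[|]]] //= ?; [left|right]; apply/val_inj.
- by rewrite /= mul0r mul1r add0r.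
- by rewrite /= mul0r mulN1r addr0.
Qed.

Definition gap_term i j : term :=
  let d c := Add (Coord i c) (Mul (Const (-1)) (Coord j c)) in
  Add (Mul (d 0) (d 0)) (Mul (d 1) (d 1)).

Definition disagreement_term : term :=
  Mul (Const (2^-1)%R) (Sum (fun i => Sum (fun j => gap_term i j))).

Definition cost_term G i : term :=
  Mul (Const (2^-1)%R) (Sum (fun j => if G i j then gap_term i j else Const 0)).

Lemma eval_gap x tau i j : eval x tau (gap_term i j) = gap x i j.
Proof. by rewrite gapE /=; ring. Qed.

Lemma eval_disagreement x tau : eval x tau disagreement_term = disagreement x.
Proof.
rewrite /= /disagreement; congr (_ * _); apply: eq_bigr => i _.
by apply: eq_bigr => j _; exact: (eval_gap x tau).
Qed.

Lemma eval_cost G x tau i : eval x tau (cost_term G i) = cost G x i.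
Proof.
rewrite /cost /= [in RHS]big_mkcond/=; congr (_ * _); apply: eq_bigr => j _.
by case: ifP => _ //; exact: (eval_gap x tau).
Qed.

Lemma tau_free_disagreement : tau_free disagreement_term.
Proof. by do !split. Qed.

Lemma tau_free_cost G i : tau_free (cost_term G i).
Proof. by split => //= j; case: ifP => // _; do !split. Qed.

Lemma eval_deriv_gap x tau l i j :
  eval x tau (deriv_rot l (gap_term i j)) =
  - 2 * ((i == l)%:R - (j == l)%:R) * wedge x i j.
Proof.
rewrite /wedge /=; case: eqP => [->|_]; case: eqP => [->|_] /=; ring.
Qed.

Lemma wedgeC x i j : wedge x i j = - wedge x j i.
Proof. by rewrite /wedge; ring. Qed.

Lemma eval_deriv_disagreement x tau l :
  eval x tau (deriv_rot l disagreement_term) = - 2 * \sum_j wedge x l j.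
Proof.
have -> : eval x tau (deriv_rot l disagreement_term) =
    2^-1 * \sum_i \sum_j eval x tau (deriv_rot l (gap_term i j)).
  by rewrite [LHS]/= mul0r add0r.
have -> : \sum_i \sum_j eval x tau (deriv_rot l (gap_term i j)) =
    \sum_i \sum_j (- 2 * ((i == l)%:R * wedge x i j)) +
    \sum_i \sum_j (2 * ((j == l)%:R * wedge x i j)).
  rewrite -big_split; apply: eq_bigr => i _; rewrite -big_split.
  by apply: eq_bigr => j _; rewrite eval_deriv_gap/=; ring.
rewrite [X in _ + X]exchange_big/= -big_split/= (bigD1 l)//= [X in _ + X]big1 => [|i il].
  rewrite addr0 -big_split/= !mulr_sumr; apply: eq_bigr => j _.
  by rewrite eqxx (wedgeC x j l)/=; field.
by rewrite (negbTE il) !big1 ?addr0// => j _; rewrite mul0r mulr0.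
Qed.

Lemma eval_deriv_cost G x tau l :
  eval x tau (deriv_rot l (cost_term G l)) = - \sum_(j | G l j) wedge x l j.
Proof.
have -> : eval x tau (deriv_rot l (cost_term G l)) = 2^-1 * \sum_j
    eval x tau (deriv_rot l (if G l j then gap_term l j else Const 0)).
  by rewrite [LHS]/= mul0r add0r.
rewrite mulr_sumr -sumrN [RHS]big_mkcond/=.
apply: eq_bigr => j _; case: ifP => _; last by rewrite mulr0.
rewrite eval_deriv_gap eqxx/=.
(* A loop of the graph contributes nothing, as [wedge x l l] vanishes. *)
have [->|_] := eqVneq j l; first by rewrite /wedge; ring.
by rewrite /=; field.
Qed.

(** A common rotation preserves all distances. In coordinates, the double sum of the antisymmetric
    [wedge] equals its own opposite. *)
Lemma sum_deriv_disagreement x tau :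
  \sum_l eval x tau (deriv_rot l disagreement_term) = 0.
Proof.
under eq_bigr do rewrite eval_deriv_disagreement.
rewrite -mulr_sumr; set S := \sum_i _.
have : S = - S.
  rewrite {1}/S exchange_big/= -sumrN; apply: eq_bigr => i _.
  by rewrite -sumrN; apply: eq_bigr => j _; exact: wedgeC.
lra.
Qed.

(** For each [l], the product of the derivatives of the disagreement and of the cost of [l] under
    rotation of oscillator [l]; their minus signs cancel. *)
Definition dissipation G x : R :=
  \sum_l (2 * \sum_j wedge x l j) * (\sum_(j | G l j) wedge x l j).

Lemma exchange_graph_sum G (F : 'I_r -> 'I_r -> R) : symmetric G ->
  \sum_i \sum_(j | G i j) F i j = \sum_i \sum_(j | G i j) F j i.
Proof.
move=> Gs; rewrite (exchange_big_dep xpredT)//=; apply: eq_bigr => i _.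
by apply: eq_bigl => j; rewrite Gs.
Qed.

(** In angles this rests on sin(a-b) (sin(a-m) - sin(b-m)) = (1 - cos(a-b)) (cos(a-m) + cos(b-m)),
    applied to each edge and each [m]. *)
Lemma dissipationE G x : symmetric G -> torus x -> dissipation G x =
  \sum_i \sum_(j | G i j) (1 - dot x i j) * \sum_m (dot x i m + dot x j m).
Proof.
move=> Gs xT; pose p i := \sum_j wedge x i j.
have -> : dissipation G x =
    \sum_i \sum_(j | G i j) wedge x i j * (p i - p j).
  (* The factor 2 gives two copies; swapping the ends of the edges in one of them turns [p i] into
     [- p j]. *)
  transitivity (\sum_i \sum_(j | G i j) wedge x i j * p i +
                \sum_i \sum_(j | G i j) wedge x i j * p i).
    rewrite -big_split/=; apply: eq_bigr => i _.
    by rewrite -mulr_suml /p; ring.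
  rewrite [X in _ + X]exchange_graph_sum// -big_split/=.
  apply: eq_bigr => i _; rewrite -big_split/=; apply: eq_bigr => j _.
  by rewrite (wedgeC x j i); ring.
apply: eq_bigr => i _; apply: eq_bigr => j _; rewrite /p -sumrB !mulr_sumr.
apply: eq_bigr => m _.
have := xT i; have := xT j; rewrite !euclid_sq_osc /dot /wedge => xj xi.
apply/eqP; rewrite -subr_eq0; apply/eqP.
(* The difference of the two sides, written in the ideal generated by the two unit circle
   equations. *)
transitivity (
  x m 0 * (x j 0 * (x i 0 * x i 0 + x i 1 * x i 1 - 1) +
           x i 0 * (x j 0 * x j 0 + x j 1 * x j 1 - 1)) +
  x m 1 * (x j 1 * (x i 0 * x i 0 + x i 1 * x i 1 - 1) +
           x i 1 * (x j 0 * x j 0 + x j 1 * x j 1 - 1))).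
  by ring.
by rewrite xi xj; ring.
Qed.

Definition graph_gap G x : R := \sum_i \sum_(j | G i j) gap x i j.

(** Below level 1 every gap is less than 2, so all inner products are nonnegative and each row sum
    is at least its diagonal entry 1. The second factor in [dissipationE] is therefore at least
    2. *)
Lemma dissipation_ge G x : symmetric G -> torus x -> disagreement x < 1 ->
  graph_gap G x <= dissipation G x.
Proof.
move=> Gs xT V1; rewrite dissipationE//.
have dot0 i j : 0 <= dot x i j.
  have := gap_le_disagreement x i j; rewrite gap_torus//; lra.
have dotii i : dot x i i = 1 by rewrite -euclid_sq_osc; exact: xT.
have sum1 i : 1 <= \sum_m dot x i m.
  by rewrite (bigD1 i)//= dotii lerDl sumr_ge0.
apply: ler_sum => i _; apply: ler_sum => j _.
have := gap_ge0 x i j; rewrite gap_torus// mulrC => g0.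
apply: ler_wpM2l; first lra.
by rewrite big_split/=; have := sum1 i; have := sum1 j; lra.
Qed.

Lemma graph_gap_ge0 G x : 0 <= graph_gap G x.
Proof. by apply: sumr_ge0 => i _; apply: sumr_ge0 => j _; exact: gap_ge0. Qed.

Lemma gap_le_graph_gap G x i j : G i j -> gap x i j <= graph_gap G x.
Proof.
move=> Gij; rewrite /graph_gap (bigD1 i)//= (bigD1 j)//= -addrA lerDl.
rewrite addr_ge0//; apply: sumr_ge0 => k _; first exact: gap_ge0.
by apply: sumr_ge0 => l _; exact: gap_ge0.
Qed.

Lemma path_gap G p i : path G i p -> exists2 K, 0 <= K &
  forall x, gap x i (last i p) <= K * graph_gap G x.
Proof.
elim: p i => [|k p IH] i /=.
  by exists 0 => // x; rewrite gapE; nra.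
move=> /andP[Gik /IH[K K0 KP]]; exists (2 + 2 * K); first lra.
move=> x; have := gap_triangle x i k (last k p); have := KP x.
have := gap_le_graph_gap x Gik; lra.
Qed.

(** One path is chosen for each pair of vertices and the constants of [path_gap] are added up; the
    extra 1 makes the result positive. *)
Lemma disagreement_le_graph_gap G : (forall i j, connect G i j) ->
  exists2 K, 0 < K & forall x, disagreement x <= K * graph_gap G x.
Proof.
move=> Gc.
have : forall ij : 'I_r * 'I_r, exists K, 0 <= K /\
    forall x, gap x ij.1 ij.2 <= K * graph_gap G x.
  move=> [i j]; have /connectP[p /path_gap[K K0 KP] ->] := Gc i j.
  by exists K.
move=> /choice[K KP].
have K0 : 0 <= \sum_i \sum_j K (i, j).
  by apply: sumr_ge0 => i _; apply: sumr_ge0 => j _; have [] := KP (i, j).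
exists (2^-1 * (\sum_i \sum_j K (i, j)) + 1); first lra.
move=> x; rewrite mulrDl -mulrA /disagreement mul1r.
have : \sum_i \sum_j gap x i j <= (\sum_i \sum_j K (i, j)) * graph_gap G x.
  rewrite mulr_suml; apply: ler_sum => i _; rewrite mulr_suml.
  by apply: ler_sum => j _; have [_ /(_ x)] := KP (i, j).
have := graph_gap_ge0 G x; lra.
Qed.

End Oscillators.

(** * Second-order averaging *)

Section Averaging.
Variables (R : realType) (r : nat).
Local Notation term := (term R r).
Variables (w : 'I_r -> R) (kappa : R) (G : rel 'I_r) (al : 'I_r -> R).
Hypotheses (w_gt0 : forall i, 0 < w i) (w_inj : injective w)
  (kappa_gt0 : 0 < kappa) (al_sq : forall i, al i * al i = 1).
Implicit Types (x : 'M[R]_(r, 2)) (tau : R).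

(** The signed control of oscillator [l] is [eps^-1] times [drive l]; with this factor split off,
    the terms below do not depend on [eps]. *)
Definition amplitude l : R := al l * Num.sqrt (2 * w l) * (Num.sqrt kappa)^-1.

Definition phase l : term := Mul (Const kappa) (cost_term R G l).

Definition drive l : term := Mul (Const (amplitude l)) (Cos (w l) (phase l)).

Lemma eval_drive x tau l : eval x tau (drive l) =
  amplitude l * cos (w l * tau + kappa * cost G x l).
Proof. by rewrite -(eval_cost G x tau). Qed.

Definition lie_drive (e : term) : term :=
  Sum (fun l => Mul (drive l) (deriv_rot l e)).

Definition lie_drift (e : term) : term := Sum (fun l => deriv_rot l e).

(* Primitives in tau of [sin (Theta_l) * cos (Theta_m)] and of the oscillating
   part of [cos (Theta_l) * cos (Theta_m)], with [Theta_l = w_l tau + kappa J_l];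
   for [l = m] the factor [(w_l - w_m)^-1] is 0. *)
Definition sincos_primitive l m : term :=
  Add (Mul (Const (- (2 * (w l + w m))^-1))
           (Cos (w l + w m) (Add (phase l) (phase m))))
      (Mul (Const (- (2 * (w l - w m))^-1))
           (Cos (w l - w m) (Add (phase l) (Mul (Const (-1)) (phase m))))).

Definition coscos_primitive l m : term :=
  Add (Mul (Const ((2 * (w l + w m))^-1))
           (Sin (w l + w m) (Add (phase l) (phase m))))
      (Mul (Const ((2 * (w l - w m))^-1))
           (Sin (w l - w m) (Add (phase l) (Mul (Const (-1)) (phase m))))).

Local Notation V := (disagreement_term R r).

(** A primitive in [tau] of minus [lie_drive V], bounded because it contains no resonant term. *)
Definition corrector1 : term :=
  Sum (fun l => Mul (Const (- (amplitude l / w l)))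
                    (Mul (deriv_rot l V) (Sin (w l) (phase l)))).

(** A primitive in [tau] of the oscillating part of minus [lie_drive corrector1]. By the product
    rule, differentiating [deriv_rot l V] gives the sine-cosine terms and differentiating the phase
    gives the cosine-cosine terms. *)
Definition corrector2 : term :=
  Sum (fun m => Sum (fun l => Mul (Const (amplitude m * (amplitude l / w l)))
    (Add (Mul (deriv_rot m (deriv_rot l V)) (sincos_primitive l m))
         (Mul (Mul (deriv_rot l V) (deriv_rot m (phase l)))
              (coscos_primitive l m))))).

Let tfV : tau_free V := @tau_free_disagreement R r.

Let tf_phase l : tau_free (phase l).
Proof. by split => //; exact: tau_free_cost. Qed.

(** The square removes the sign and the scaling of the amplitude removes the frequency: on average,
    all control directions and frequencies act alike. *)
Lemma amplitude_sq l : amplitude l * (amplitude l / w l) = 2 / kappa.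
Proof.
have k0 : Num.sqrt kappa != 0 by rewrite gt_eqF// sqrtr_gt0.
transitivity (al l * al l * (Num.sqrt (2 * w l) ^+ 2 / w l)
    / (Num.sqrt kappa ^+ 2)).
  by rewrite /amplitude; field; rewrite k0 gt_eqF.
rewrite al_sq !sqr_sqrtr ?ltW// ?mulr_gt0//.
by field; rewrite !gt_eqF.
Qed.

Lemma drive_cancel1 x tau :
  eval x tau (lie_drive V) + eval x tau (deriv_tau corrector1) = 0.
Proof.
rewrite /lie_drive /corrector1; cbn [eval deriv_tau]; rewrite -big_split big1// => l _.
rewrite /drive; cbn [eval].
rewrite (eval_deriv_tau0 x tau (tau_free_deriv_rot l tfV)).
rewrite (eval_deriv_tau0 x tau (tf_phase l)).
by rewrite /=; field; rewrite gt_eqF.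
Qed.

Let theta x tau l := w l * tau + eval x tau (phase l).

Lemma deriv_tau_sincos x tau l m :
  eval x tau (deriv_tau (sincos_primitive l m)) =
  sin (theta x tau l) * cos (theta x tau m).
Proof.
have -> : eval x tau (deriv_tau (sincos_primitive l m)) =
    (2 * (w l + w m))^-1 * (w l + w m) * sin (theta x tau l + theta x tau m) +
    (2 * (w l - w m))^-1 * (w l - w m) * sin (theta x tau l - theta x tau m).
  rewrite /sincos_primitive; cbn [eval deriv_tau].
  rewrite !(eval_deriv_tau0 x tau (tf_phase _)) /theta.
  have -> : w l * tau + eval x tau (phase l) + (w m * tau + eval x tau (phase m))
    = (w l + w m) * tau + (eval x tau (phase l) + eval x tau (phase m)) by ring.
  have -> : w l * tau + eval x tau (phase l) - (w m * tau + eval x tau (phase m))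
    = (w l - w m) * tau + (eval x tau (phase l) + -1 * eval x tau (phase m))
    by ring.
  ring.
have h : (2 * (w l + w m))^-1 * (w l + w m) = 2^-1.
  by field; rewrite gt_eqF// addr_gt0.
(* For equal indices half of the sine of the doubled phase is already the product, so no mean
   remains. Otherwise the frequencies differ and both divisions are genuine. *)
rewrite h sinD sinB; have [->|lm] := eqVneq l m.
  by rewrite subrr !mulr0 mul0r addr0; field.
have -> : (2 * (w l - w m))^-1 * (w l - w m) = 2^-1.
  by field; rewrite subr_eq0 (inj_eq w_inj).
by field.
Qed.

Lemma deriv_tau_coscos x tau l m :
  eval x tau (deriv_tau (coscos_primitive l m)) =
  cos (theta x tau l) * cos (theta x tau m) - (l == m)%:R / 2.
Proof.
have -> : eval x tau (deriv_tau (coscos_primitive l m)) =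
    (2 * (w l + w m))^-1 * (w l + w m) * cos (theta x tau l + theta x tau m) +
    (2 * (w l - w m))^-1 * (w l - w m) * cos (theta x tau l - theta x tau m).
  rewrite /coscos_primitive; cbn [eval deriv_tau].
  rewrite !(eval_deriv_tau0 x tau (tf_phase _)) /theta.
  have -> : w l * tau + eval x tau (phase l) + (w m * tau + eval x tau (phase m))
    = (w l + w m) * tau + (eval x tau (phase l) + eval x tau (phase m)) by ring.
  have -> : w l * tau + eval x tau (phase l) - (w m * tau + eval x tau (phase m))
    = (w l - w m) * tau + (eval x tau (phase l) + -1 * eval x tau (phase m))
    by ring.
  ring.
have h : (2 * (w l + w m))^-1 * (w l + w m) = 2^-1.
  by field; rewrite gt_eqF// addr_gt0.
(* For equal indices half of the cosine of the doubled phase is the squared cosine minus its mean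
   1/2, the only resonance. *)
rewrite h cosD cosB; have [->|lm] := eqVneq l m.
  have := cos2Dsin2 (theta x tau m).
  move: (cos _) (sin _) => c s cs; have -> : s * s = 1 - c * c by rewrite -cs; ring.
  by rewrite subrr !mulr0 mul0r addr0/=; field.
have -> : (2 * (w l - w m))^-1 * (w l - w m) = 2^-1.
  by field; rewrite subr_eq0 (inj_eq w_inj).
by rewrite /=; field.
Qed.

Lemma drive_cancel2 x tau :
  eval x tau (lie_drive corrector1) + eval x tau (deriv_tau corrector2) =
  - dissipation G x.
Proof.
pose H m l := eval x tau (deriv_rot m (deriv_rot l V)).
pose g l := eval x tau (deriv_rot l V).
pose F m l := eval x tau (deriv_rot m (phase l)).
have -> : eval x tau (lie_drive corrector1) = - \sum_m \sum_l
    amplitude m * (amplitude l / w l) *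
    (H m l * (sin (theta x tau l) * cos (theta x tau m)) +
     g l * F m l * (cos (theta x tau l) * cos (theta x tau m))).
  rewrite /lie_drive /corrector1; cbn [eval deriv_rot]; rewrite -sumrN.
  apply: eq_bigr => m _; rewrite mulr_sumr -sumrN; apply: eq_bigr => l _.
  by rewrite /H /g /F /theta; cbn [eval drive deriv_rot]; ring.
have -> : eval x tau (deriv_tau corrector2) = \sum_m \sum_l
    amplitude m * (amplitude l / w l) *
    (H m l * (sin (theta x tau l) * cos (theta x tau m)) +
     g l * F m l * (cos (theta x tau l) * cos (theta x tau m) - (l == m)%:R / 2)).
  rewrite /corrector2; cbn [eval deriv_tau].
  apply: eq_bigr => m _; apply: eq_bigr => l _.
  rewrite deriv_tau_sincos deriv_tau_coscos.
  rewrite (eval_deriv_tau0 x tau (tau_free_deriv_rot m (tau_free_deriv_rot l tfV))).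
  rewrite (eval_deriv_tau0 x tau (tau_free_deriv_rot l tfV)).
  rewrite (eval_deriv_tau0 x tau (tau_free_deriv_rot m (tf_phase l))).
  by rewrite /H /g /F; ring.
rewrite -sumrN -big_split/= /dissipation -sumrN; apply: eq_bigr => m _.
(* Only the diagonal keeps a mean. There [amplitude_sq] contributes [2 / kappa], and the [kappa] of
   the phase cancels it. *)
rewrite -sumrN -big_split/= (bigD1 m)//= big1 => [|l lm]; last first.
  by rewrite (negbTE lm)/=; ring.
rewrite eqxx addr0 amplitude_sq /g eval_deriv_disagreement.
have -> : F m m = - kappa * \sum_(j | G m j) wedge x m j.
  rewrite /F /phase; cbn [eval deriv_rot]; rewrite eval_deriv_cost.
  by rewrite mul0r add0r mulrN mulNr.
by rewrite /=; field; rewrite gt_eqF.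
Qed.

Definition lyapunov (eps : R) x tau : R :=
  eval x tau V + eps * eval x tau corrector1 + eps ^+ 2 * eval x tau corrector2.

Definition remainder (eps : R) x tau : R :=
  eps * (eval x tau (lie_drift corrector1) + eval x tau (lie_drive corrector2)) +
  eps ^+ 2 * eval x tau (lie_drift corrector2).

(** Order by order in [eps]: at -2 the disagreement does not depend on [tau]; at -1 [drive_cancel1]
    applies; at 0 the drift preserves the disagreement and [drive_cancel2] leaves the dissipation.
    The positive orders form [remainder]. *)
Lemma lyapunov_derive (eps : R) (x : R -> 'M[R]_(r, 2)) (tau : R -> R) t :
  0 < eps ->
  (forall i c, is_derive t (1 : R) (fun s => x s i c)
     ((1 + eps^-1 * eval (x t) (tau t) (drive i)) * rot_coord (x t) i c)) ->
  is_derive t (1 : R) tau (eps ^- 2) ->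
  is_derive t (1 : R) (fun s => lyapunov eps (x s) (tau s))
    (- dissipation G (x t) + remainder eps (x t) (tau t)).
Proof.
move=> eps0 xd taud.
have E e : is_derive t (1 : R) (fun s => eval (x s) (tau s) e)
    (eps ^- 2 * eval (x t) (tau t) (deriv_tau e) +
     eps^-1 * eval (x t) (tau t) (lie_drive e) + eval (x t) (tau t) (lie_drift e)).
  have := is_derive_eval e xd taud; congr is_derive.
  rewrite -addrA; congr (_ + _); rewrite /lie_drive /lie_drift; cbn [eval].
  rewrite mulr_sumr -big_split/=; apply: eq_bigr => l _; ring.
have EV := E V; have E1 := E corrector1; have E2 := E corrector2.
apply: is_derive_eq.
rewrite (eval_deriv_tau0 _ _ tfV).
have -> : eval (x t) (tau t) (lie_drift V) = 0 by exact: sum_deriv_disagreement.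
have h1 := drive_cancel1 (x t) (tau t).
have h2 := drive_cancel2 (x t) (tau t).
rewrite -h2 /remainder; move: h1.
move: (eval _ _ (lie_drive V)) (eval _ _ (deriv_tau corrector1))
  (eval _ _ (lie_drive corrector1)) (eval _ _ (deriv_tau corrector2))
  (eval _ _ (lie_drift corrector1)) (eval _ _ (lie_drive corrector2))
  (eval _ _ (lie_drift corrector2)) => a b c d e f g /eqP.
rewrite addr_eq0 => /eqP ->; rewrite /GRing.scale/=.
by field; rewrite gt_eqF.
Qed.

Lemma lyapunov_bound : exists2 M : R, 0 <= M &
  forall eps x tau, 0 < eps <= 1 -> torus x ->
    `|lyapunov eps x tau - disagreement x| <= M * eps /\
    `|remainder eps x tau| <= M * eps.
Proof.
pose M := bound corrector1 + bound corrector2 + bound (lie_drift corrector1) +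
  bound (lie_drive corrector2) + bound (lie_drift corrector2).
exists M => [|eps x tau /andP[eps0 eps1] xT]; first by rewrite !addr_ge0 ?bound_ge0.
have xB := torus_unit_box xT.
have b e : `|eval x tau e| <= bound e by exact: eval_bound.
have b0 (e : term) : 0 <= bound e by exact: bound_ge0.
have e2 : eps ^+ 2 <= eps by rewrite expr2 ger_pMl.
have est (y z : R) : `|y| <= z -> eps * `|y| <= z * eps.
  by move=> yz; rewrite mulrC ler_wpM2r// ltW.
have est2 (y z : R) : `|y| <= z -> eps ^+ 2 * `|y| <= z * eps.
  by move=> yz; rewrite mulrC; apply: ler_pM => //; exact: sqr_ge0.
have pos (e : term) : 0 <= bound e * eps by rewrite mulr_ge0// ltW.
split.
  rewrite /lyapunov eval_disagreement.
  have -> : disagreement x + eps * eval x tau corrector1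
    + eps ^+ 2 * eval x tau corrector2 - disagreement x =
    eps * eval x tau corrector1 + eps ^+ 2 * eval x tau corrector2 by ring.
  apply: le_trans (ler_normD _ _) _.
  rewrite (normrM eps) (normrM (eps ^+ 2)) normrX (gtr0_norm eps0).
  have := est _ _ (b corrector1); have := est2 _ _ (b corrector2).
  rewrite /M !mulrDl; have := pos (lie_drift corrector1).
  have := pos (lie_drive corrector2); have := pos (lie_drift corrector2); lra.
rewrite /remainder; apply: le_trans (ler_normD _ _) _.
rewrite (normrM eps) (normrM (eps ^+ 2)) normrX (gtr0_norm eps0).
have : eps * `|eval x tau (lie_drift corrector1) + eval x tau (lie_drive corrector2)|
    <= (bound (lie_drift corrector1) + bound (lie_drive corrector2)) * eps.
  by apply: est; apply: le_trans (ler_normD _ _) _; exact: lerD.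
have := est2 _ _ (b (lie_drift corrector2)).
rewrite /M !mulrDl; have := pos corrector1; have := pos corrector2; lra.
Qed.

(** Used to make the function absolutely continuous along solutions, so the constant may depend on
    [eps]. *)
Lemma lyapunov_lip (eps : R) : exists2 K : R, 0 <= K &
  forall x x' tau tau', torus x -> torus x' ->
    `|lyapunov eps x tau - lyapunov eps x' tau'| <=
      K * (`|x - x'| + `|tau - tau'|).
Proof.
pose K := lip V + `|eps| * lip corrector1 + `|eps ^+ 2| * lip corrector2.
exists K => [|x x' tau tau' xT xT'].
  apply: addr_ge0; [apply: addr_ge0; first exact: lip_ge0|];
    by apply: mulr_ge0 => //; exact: lip_ge0.
have b e : `|eval x tau e - eval x' tau' e| <= lip e * (`|x - x'| + `|tau - tau'|).
  by apply: eval_lip; exact: torus_unit_box.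
have -> : lyapunov eps x tau - lyapunov eps x' tau' =
  (eval x tau V - eval x' tau' V) +
  eps * (eval x tau corrector1 - eval x' tau' corrector1) +
  eps ^+ 2 * (eval x tau corrector2 - eval x' tau' corrector2).
  by rewrite /lyapunov; ring.
rewrite /K (mulrDl (lip V + _)) (mulrDl (lip V)).
apply: le_trans (ler_normD _ _) _; apply: lerD.
  apply: le_trans (ler_normD _ _) _; apply: lerD; first exact: b.
  by rewrite normrM -mulrA ler_wpM2l.
by rewrite normrM -mulrA ler_wpM2l.
Qed.

End Averaging.

(** * The energy along flows and jumps *)

Section Coordinates.
Variables (R : realType) (W : normedModType R).

(** Covers the coordinates of the state. The first clause is linearity in the shape in which
    difference quotients use it; the second transfers absolute continuity and limits. *)
Definition contracting_form (L : W -> R) :=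
  (forall a u v, L (a *: (u - v)) = a * (L u - L v)) /\
  (forall u, `|L u| <= `|u|).

Lemma contracting_form_sub L u v : contracting_form L ->
  L u - L v = L (u - v).
Proof. by move=> [Ll _]; rewrite -(scale1r (u - v)) Ll mul1r. Qed.

Lemma contracting_form_dist L u v : contracting_form L ->
  `|L u - L v| <= `|u - v|.
Proof. by move=> LL; rewrite (contracting_form_sub _ _ LL); case: LL => _; exact. Qed.

Lemma contracting_form_derive L (y : R -> W) t v : contracting_form L ->
  is_derive t (1 : R) y v -> is_derive t (1 : R) (L \o y) (L v).
Proof.
move=> LL [yd yv].
have yl : h^-1 *: ((y \o shift t) (h *: (1 : R)) - y t) @[h --> 0^'] --> v.
  by rewrite -yv; exact: yd.
have Ll : h^-1 *: ((L \o y \o shift t) (h *: (1 : R)) - (L \o y) t) @[h --> 0^']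
    --> L v.
  apply/cvgrPdist_le => e e0; move/cvgrPdist_le: yl => /(_ e e0).
  apply: filterS => h /=; apply: le_trans.
  have [LZ _] := LL.
  have -> : h^-1 *: (L (y (h%:A + t)) - L (y t)) =
    L (h^-1 *: (y (h%:A + t) - y t)) by rewrite LZ.
  exact: contracting_form_dist.
split; first by apply/cvg_ex; exists (L v).
exact/cvg_lim.
Qed.

End Coordinates.

Section StateCoordinates.
Variables (R : realType) (r : nat).
Local Notation state := (osc_state R r).
Implicit Types s : state.

Definition st_x s : osc_space R r := s.1.1.
Definition st_z1 s : R := s.1.2.1.1.
Definition st_z2 s : R := s.1.2.1.2.
Definition st_tau2 s : R := s.2.2.

Lemma norm_fst (U U' : normedModType R) (p : U * U') : `|p.1| <= `|p|.
Proof. by rewrite prod_normE le_max lexx. Qed.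

Lemma norm_snd (U U' : normedModType R) (p : U * U') : `|p.2| <= `|p|.
Proof. by rewrite prod_normE le_max lexx orbT. Qed.

Lemma norm_st_x s s' : `|st_x s - st_x s'| <= `|s - s'|.
Proof.
apply: le_trans (norm_fst (s - s')); exact: (norm_fst (s - s').1).
Qed.

Lemma contracting_x i c : contracting_form (fun s => st_x s i c).
Proof.
split => [a u v|u]; first by rewrite /st_x/= !mxE.
apply: le_trans (coord_norm _ _ _) _.
apply: le_trans (norm_fst u); exact: (norm_fst u.1).
Qed.

Lemma contracting_z1 : contracting_form st_z1.
Proof.
split => // u; apply: le_trans (norm_fst u); apply: le_trans (norm_snd u.1).
by apply: le_trans (norm_fst u.1.2); exact: (norm_fst u.1.2.1).
Qed.

Lemma contracting_z2 : contracting_form st_z2.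
Proof.
split => // u; apply: le_trans (norm_fst u); apply: le_trans (norm_snd u.1).
by apply: le_trans (norm_fst u.1.2); exact: (norm_snd u.1.2.1).
Qed.

Lemma contracting_tau2 : contracting_form st_tau2.
Proof.
split => // u; apply: le_trans (norm_snd u); exact: (norm_snd u.2).
Qed.

End StateCoordinates.

Section FlowArc.
Variables (R : realType) (r n N2 : nat) (w : 'I_r -> R) (kappa : R).
Variables (G : 'I_N2 -> rel 'I_r) (mode : 'I_n -> 'I_N2 * direction r).
Variables (eta2 N0 T0 : R).
Hypotheses (w_gt0 : forall i, 0 < w i) (w_inj : injective w)
  (kappa_gt0 : 0 < kappa) (Gs : forall k, symmetric (G k))
  (Gc : forall k i j, connect (G k) i j) (N0_ge0 : 0 <= N0).
Local Notation state := (osc_state R r).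
Implicit Types (s : state) (q : 'I_n).

Let sgn q i := sign_of R (mode q).2 i.
Let graph q := G (mode q).1.

Lemma sign_of_sq (alpha : direction r) i :
  sign_of R alpha i * sign_of R alpha i = 1.
Proof. by rewrite /sign_of -expr2 sqrr_sign. Qed.

Lemma mode_value_inj : injective (@mode_value R n).
Proof.
move=> i j /eqP; rewrite /mode_value eqr_nat eqSS => /eqP ij.
exact: val_inj.
Qed.

Lemma flow_mapP eta1 eps s v : osc_flow_map w kappa G mode eta2 eta1 eps s v ->
  exists2 q, st_z1 s = mode_value R q &
  [/\ forall i c, st_x v i c =
        (1 + eps^-1 * eval (st_x s) (st_tau2 s) (drive w kappa (graph q) (sgn q) i))
        * rot_coord (st_x s) i c,
      st_z1 v = 0, st_z2 v <= eta1 & st_tau2 v = eps ^- 2].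
Proof.
move: s v => [[x [[z1 z2] z3]] [t1 t2]] [[dx [[dz1 dz2] dz3]] [dt1 dt2]].
move=> [[q z1q dxE] [dz10 /andP[_ dz2e] _] _ dt2E]; exists q => //; split => // i c.
have := congr1 (fun m : 'cV_2 => m c 0) (dxE i).
rewrite [LHS]mxE [(row i dx) 0 c]mxE [in RHS]mxE rotation_osc => ->.
congr ((1 + _) * _); rewrite /control eval_drive /amplitude /sgn /st_x /st_tau2/=.
by rewrite -/(graph q); ring.
Qed.

(** Since the modes switch, one rate must serve all graphs; summing the finitely many constants
    dominates each of them. *)
Lemma uniform_dissipation : exists2 c : R, 0 < c & forall k x, torus x ->
  disagreement x < 1 -> c * disagreement x <= dissipation (G k) x.
Proof.
have : forall k, exists K, 0 < K /\
    forall x : osc_space R r, disagreement x <= K * graph_gap (G k) x.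
  by move=> k; have [K K0 KP] := @disagreement_le_graph_gap R r _ (Gc k); exists K.
move=> /choice[K KP].
have K0 k : 0 < K k by case: (KP k).
have S0 : 0 <= \sum_k K k by apply: sumr_ge0 => k _; exact: ltW.
exists (\sum_k K k + 1)^-1; first by rewrite invr_gt0; lra.
move=> k x xT x1; apply: le_trans (dissipation_ge (Gs k) xT x1).
rewrite mulrC ler_pdivrMr; last lra.
have [_ /(_ x) /le_trans] := KP k; apply.
rewrite mulrC ler_wpM2l ?graph_gap_ge0// (bigD1 k)//= -addrA lerDl addr_ge0//.
by apply: sumr_ge0 => i _; exact: ltW.
Qed.

Definition lyap eps q (x : osc_space R r) tau :=
  lyapunov w kappa (graph q) (sgn q) eps x tau.

Lemma uniform_lyapunov_bound : exists2 M : R, 0 <= M &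
  forall q eps x tau, 0 < eps <= 1 -> torus x ->
    `|lyap eps q x tau - disagreement x| <= M * eps /\
    `|remainder w kappa (graph q) (sgn q) eps x tau| <= M * eps.
Proof.
have : forall q, exists K, 0 <= K /\ forall eps x tau, 0 < eps <= 1 -> torus x ->
    `|lyap eps q x tau - disagreement x| <= K * eps /\
    `|remainder w kappa (graph q) (sgn q) eps x tau| <= K * eps.
  move=> q; have [K K0 KP] := lyapunov_bound w kappa (graph q) (sgn q).
  by exists K.
move=> /choice[K KP].
have K0 q : 0 <= K q by case: (KP q).
exists (\sum_q K q); first by apply: sumr_ge0 => q _; exact: K0.
move=> q eps x tau epsP xT; have [_ /(_ eps x tau epsP xT)[h1 h2]] := KP q.
have KS : K q * eps <= (\sum_q K q) * eps.
  have /andP[e0 _] := epsP; apply: ler_wpM2r; first exact: ltW.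
  by rewrite (bigD1 q)//= lerDl; apply: sumr_ge0 => k _; exact: K0.
by split; exact: le_trans KS.
Qed.

Variables (c M : R).
Hypotheses (c_gt0 : 0 < c)
  (c_le : forall k (x : osc_space R r), torus x -> disagreement x < 1 ->
     c * disagreement x <= dissipation (G k) x)
  (M_ge0 : 0 <= M)
  (M_le : forall q eps x tau, 0 < eps <= 1 -> torus x ->
    `|lyap eps q x tau - disagreement x| <= M * eps /\
    `|remainder w kappa (graph q) (sgn q) eps x tau| <= M * eps).

(* The clock term pays for the jump of [lyap] when the mode is switched. *)
Definition energy eps q s : R :=
  lyap eps q (st_x s) (st_tau2 s) + M * eps + 2 * M * eps * st_z2 s.

(** In units of [eps]: the first two summands bound the excess of [energy] over the disagreement,
    and the last is the level at which the rate [c] balances the remainder, [M], plus the clock,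
    [2 * M]. *)
Definition residual : R := 2 * M + 2 * M * N0 + 3 * M / c.

Lemma residual_ge0 : 0 <= residual.
Proof.
by rewrite /residual !addr_ge0// ?mulr_ge0// ?invr_ge0 ltW.
Qed.

Definition admissible s := torus (st_x s) /\ Cz n N0 T0 s.1.2.

(** The summand [M * eps] outweighs the correctors from below, and the clock term is controlled by
    [st_z2 s] lying between 0 and [N0]. *)
Lemma energy_bounds eps q s : 0 < eps <= 1 -> admissible s ->
  disagreement (st_x s) <= energy eps q s /\
  energy eps q s <= disagreement (st_x s) + (2 * M + 2 * M * N0) * eps.
Proof.
move=> epsP [xT [_ /andP[z20 z2N] _]]; rewrite /energy.
have [] := M_le q (st_tau2 s) epsP xT; rewrite ler_norml => /andP[h1 h2] _.
have /andP[e0 e1] := epsP.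
have Me : 0 <= 2 * M * eps by rewrite mulr_ge0 ?mulr_ge0// ltW.
have z2E : st_z2 s = s.1.2.1.2 by [].
have h3 : 0 <= 2 * M * eps * st_z2 s by rewrite mulr_ge0.
have h4 : 2 * M * eps * st_z2 s <= 2 * M * eps * N0 by rewrite ler_wpM2l.
split; first lra.
have -> : (2 * M + 2 * M * N0) * eps = M * eps + M * eps + 2 * M * eps * N0 by ring.
lra.
Qed.

Section arc.
Variables (eta1 eps : R) (y : R -> state) (a b : R).
Hypotheses (eta1_le : 0 < eta1 <= 1) (epsP : 0 < eps <= 1) (ab : a <= b).
Hypotheses (yac : absolutely_continuous y a b)
  (yadm : forall t, a <= t <= b -> admissible (y t))
  (yflow : {ae lebesgue_measure, forall t : R, a < t < b ->
     exists2 v, osc_flow_map w kappa G mode eta2 eta1 eps (y t) v &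
                is_derive t (1 : R) y v}).

Lemma arc_form_ac (L : state -> R) : contracting_form L ->
  absolutely_continuous (L \o y) a b.
Proof.
move=> LL; apply: (@ac_dominated _ _ y _ _ _ 1) => // s t _ st _.
rewrite mul1r; apply: le_trans (contracting_form_dist _ _ LL) _.
by rewrite lerDl subr_ge0.
Qed.

(** With derivative zero almost everywhere, both [st_z1] and its opposite are nonincreasing. *)
Lemma arc_z1 t : a <= t <= b -> st_z1 (y t) = st_z1 (y a).
Proof.
move=> /andP[at_ tb]; apply/le_anti/andP; split.
- apply: (@ac_nonincreasing _ (@st_z1 R r \o y)) => //.
    by apply: ac_sub (arc_form_ac (@contracting_z1 R r)).
  apply: ae_imply yflow => s H /andP[as_ st].
  have [|v /flow_mapP[q _ [_ v0 _ _]] yv] := H; first by rewrite as_ (lt_le_trans st).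
  exists 0 => //; rewrite -v0; apply: contracting_form_derive yv.
  exact: contracting_z1.
- rewrite -lerN2.
  apply: (@ac_nonincreasing R (fun u => - st_z1 (y u)) a t at_).
    apply: (@ac_dominated _ _ y _ _ _ 1); first by apply: ac_sub yac.
    move=> u v _ uv _; rewrite mul1r -opprD normrN.
    apply: le_trans (contracting_form_dist _ _ (@contracting_z1 R r)) _.
    by rewrite lerDl subr_ge0.
  apply: ae_imply yflow => s H /andP[as_ st].
  have [|v /flow_mapP[q _ [_ v0 _ _]] yv] := H; first by rewrite as_ (lt_le_trans st).
  have := contracting_form_derive (@contracting_z1 R r) yv => ?.
  by exists (- st_z1 v); [rewrite v0 oppr0|exact: is_deriveN].
Qed.

Lemma arc_z2 : st_z2 (y b) <= st_z2 (y a) + (b - a).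
Proof.
suff : st_z2 (y b) - b <= st_z2 (y a) - a by lra.
apply: (@ac_nonincreasing _ (fun u => st_z2 (y u) - u)) => //.
  apply: (@ac_dominated _ _ y _ _ _ 1) => // u v _ uv _.
  have -> : st_z2 (y v) - v - (st_z2 (y u) - u) =
    (st_z2 (y v) - st_z2 (y u)) - (v - u) by ring.
  apply: le_trans (ler_normB _ _) _; rewrite mul1r.
  rewrite (ger0_norm (_ : 0 <= v - u)) ?subr_ge0// lerD2r.
  exact: (contracting_form_dist _ _ (@contracting_z2 R r)).
apply: ae_imply yflow => s H /H[v /flow_mapP[q _ [_ _ v1 _]] yv].
have := contracting_form_derive (@contracting_z2 R r) yv => ?.
by exists (st_z2 v - 1); [have := eta1_le; lra|exact: is_deriveB].
Qed.

(** The dissipation estimate holds only where the disagreement is below 1. As the energy dominates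
    the disagreement, [ac_gronwall_barrier] with level 1 applies. *)
Lemma arc_energy q : st_z1 (y a) = mode_value R q ->
  energy eps q (y a) < 1 -> residual * eps < 1 ->
  energy eps q (y b) - residual * eps <=
    expR (- c * (b - a)) * (energy eps q (y a) - residual * eps).
Proof.
move=> z1q ea1 re1.
have e0 : 0 < eps by case/andP: epsP.
have Me : 0 <= M * eps by rewrite mulr_ge0// ltW.
pose B := bound (disagreement_term R r) + (2 * M + 2 * M * N0) * eps.
have [K K0 KP] := lyapunov_lip w kappa (graph q) (sgn q) eps.
apply: (@ac_gronwall_barrier _ (fun t => disagreement (st_x (y t)))
  (fun t => energy eps q (y t)) _ _ _ _ B 1) => //.
- apply: (@ac_dominated _ _ y _ _ _ (lip (disagreement_term R r))) => // s t as_ st tb.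
  have [sT _] : admissible (y s) by apply: yadm; rewrite as_ (le_trans st).
  have [tT _] : admissible (y t) by apply: yadm; rewrite tb (le_trans as_).
  rewrite -!(eval_disagreement _ 0).
  apply: le_trans (eval_lip _ _ _ _ _) _; try exact: torus_unit_box.
  rewrite subrr normr0 addr0 ler_wpM2l ?lip_ge0//.
  by apply: le_trans (norm_st_x _ _) _; rewrite lerDl subr_ge0.
- apply: (@ac_dominated _ _ y _ _ _ (2 * K + 2 * M * eps)) => // s t as_ st tb.
  have [sT _] : admissible (y s) by apply: yadm; rewrite as_ (le_trans st).
  have [tT _] : admissible (y t) by apply: yadm; rewrite tb (le_trans as_).
  have -> : energy eps q (y t) - energy eps q (y s) =
    (lyap eps q (st_x (y t)) (st_tau2 (y t)) -
     lyap eps q (st_x (y s)) (st_tau2 (y s))) +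
    2 * M * eps * (st_z2 (y t) - st_z2 (y s)) by rewrite /energy; ring.
  apply: le_trans (ler_normD _ _) _.
  have h1 := KP _ _ (st_tau2 (y t)) (st_tau2 (y s)) tT sT.
  have h2 := norm_st_x (y t) (y s).
  have h3 := contracting_form_dist (y t) (y s) (@contracting_tau2 R r).
  have h4 := contracting_form_dist (y t) (y s) (@contracting_z2 R r).
  have MM : 0 <= 2 * M * eps by rewrite mulr_ge0 ?mulr_ge0// ltW.
  rewrite normrM (ger0_norm MM) (mulrDl (2 * K)).
  have ts : 0 <= t - s by rewrite subr_ge0.
  apply: lerD; last by rewrite ler_wpM2l//; lra.
  apply: le_trans h1 _; rewrite [2 * K]mulrC -mulrA ler_wpM2l//; lra.
- move=> t tab; have [tT tC] := yadm tab.
  have [h1 h2] := energy_bounds q epsP (yadm tab).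
  have := disagreement_ge0 (st_x (y t)).
  have := eval_bound 0 (disagreement_term R r) (torus_unit_box tT).
  rewrite eval_disagreement => /(le_trans (ler_norm _)) h3 h4.
  rewrite ger0_norm /B; lra.
- by move=> t tab; have [] := energy_bounds q epsP (yadm tab).
- apply: ae_imply yflow => t H tab V1.
  have tab' : a <= t <= b by case/andP: tab => h1 h2; rewrite !ltW.
  have [v /flow_mapP[q' z1q' [xv _ z2v tv]] yv] := H tab.
  (* The mode selected by the flow map at time [t] is the one in force at the start of the arc. *)
  have qq : q' = q by apply: mode_value_inj; rewrite -z1q' arc_z1.
  rewrite {}qq in xv.
  have [tT tC] := yadm tab'.
  have [h1 h2] := energy_bounds q epsP (yadm tab').
  have [_ h3] := M_le q (st_tau2 (y t)) epsP tT.
  have DV := c_le (mode q).1 tT V1.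
  pose rem := remainder w kappa (graph q) (sgn q) eps (st_x (y t)) (st_tau2 (y t)).
  exists (- dissipation (graph q) (st_x (y t)) + rem + 2 * M * eps * st_z2 v).
    have : 2 * M * eps * st_z2 v <= 2 * M * eps * 1.
      apply: ler_wpM2l; first by rewrite -mulrA mulr_ge0.
      by apply: le_trans z2v _; case/andP: eta1_le.
    have := le_trans (ler_norm _) h3; rewrite -/rem.
    have : c * energy eps q (y t) <=
      c * (disagreement (st_x (y t)) + (2 * M + 2 * M * N0) * eps).
      by rewrite ler_pM2l.
    have -> : - c * (energy eps q (y t) - residual * eps) =
      - (c * energy eps q (y t)) + c * ((2 * M + 2 * M * N0) * eps) + 3 * (M * eps).
      by rewrite /residual; field; rewrite gt_eqF.
    rewrite -/(graph q) in DV; lra.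
  have Ld : is_derive t (1 : R) (fun u => lyap eps q (st_x (y u)) (st_tau2 (y u)))
      (- dissipation (graph q) (st_x (y t)) + rem).
    apply: (@lyapunov_derive _ _ _ _ _ _ _ _ _ _ _
      (@st_x R r \o y) (@st_tau2 R r \o y)) => //.
    + by move=> i; exact: sign_of_sq.
    + move=> i k; rewrite /= -xv.
      exact: (contracting_form_derive (@contracting_x R r i k) yv).
    + rewrite -tv; exact: (contracting_form_derive (@contracting_tau2 R r) yv).
  have Zd := contracting_form_derive (@contracting_z2 R r) yv.
  apply: is_derive_eq; rewrite /GRing.scale/= addr0; ring.
Qed.

End arc.

Lemma jump_energy eps q q' s s' : 0 < eps <= 1 -> torus (st_x s) ->
  st_x s' = st_x s -> st_z2 s' = st_z2 s - 1 ->
  energy eps q' s' <= energy eps q s.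
Proof.
move=> epsP xT x' z2'; rewrite /energy x' z2'.
have [+ _] := M_le q (st_tau2 s) epsP xT.
have [+ _] := M_le q' (st_tau2 s') epsP xT.
rewrite !ler_norml => /andP[_ h1] /andP[h2 _].
rewrite mulrBr; lra.
Qed.

End FlowArc.

(** * Decay of the disagreement along hybrid solutions *)

Section HybridArc.
Variables (R : realType) (r n N2 : nat) (w : 'I_r -> R) (kappa : R).
Variables (G : 'I_N2 -> rel 'I_r) (mode : 'I_n -> 'I_N2 * direction r).
Variables (eta2 N0 T0 : R).
Hypotheses (w_gt0 : forall i, 0 < w i) (w_inj : injective w)
  (kappa_gt0 : 0 < kappa) (Gs : forall k, symmetric (G k))
  (Gc : forall k i j, connect (G k) i j) (N0_ge0 : 0 <= N0).
Local Notation state := (osc_state R r).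
Local Notation admissible := (@admissible R r n N0 T0).

Lemma trajectory_bound : exists c C : R, [/\ 0 < c, 0 <= C &
  forall eta1 eps E y, 0 < eta1 <= 1 -> 0 < eps <= 1 ->
    is_solution (switched_oscillators w kappa G mode eta2 N0 T0 eta1 eps) E y ->
    disagreement (st_x (y 0 0%N)) + C * eps < 1 ->
    forall t j, E (t, j) -> [/\ admissible (y t j),
      disagreement (st_x (y t j)) <=
        expR (- c * t) * disagreement (st_x (y 0 0%N)) + C * eps &
      0 <= t /\ j%:R <= N0 + t]].
Proof.
have [c c0 cP] := @uniform_dissipation R r N2 G Gs Gc.
have [M M0 MP] := @uniform_lyapunov_bound R r n N2 w kappa G mode.
pose res := residual N0 c M.
have res0 : 0 <= res by exact: residual_ge0.
have MN0 : 0 <= 2 * M + 2 * M * N0 by rewrite addr_ge0 ?mulr_ge0.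
exists c, (2 * M + 2 * M * N0 + res); split => //; first exact: addr_ge0.
move=> eta1 eps E y eta1P epsP [[E_ge0 Edom] E0 y0 yflow yjump] V0 t j Etj.
have [eps0 eps1] := andP epsP.
pose e0 := disagreement (st_x (y 0 0%N)) + (2 * M + 2 * M * N0) * eps.
have e0_ge0 : 0 <= e0.
  by rewrite addr_ge0 ?disagreement_ge0// mulr_ge0// ltW.
have e0_lt1 : e0 + res * eps < 1.
  by move: V0; rewrite (mulrDl _ res) addrA.
(* The invariant at hybrid time [(t, i)]. Its last clause counts jumps: [st_z2] grows at rate at
   most 1 and loses 1 at each jump. *)
pose Inv s t i := [/\ admissible s,
  forall q, st_z1 s = mode_value R q ->
    energy w kappa G mode M eps q s - res * eps <= expR (- c * t) * e0 &
  st_z2 s + i%:R <= N0 + t].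
have admE : forall s, (flow_set (switched_oscillators w kappa G mode eta2 N0 T0 eta1 eps)
    `|` jump_set (switched_oscillators w kappa G mode eta2 N0 T0 eta1 eps)) s ->
    admissible s.
  move=> s [[xT sC _ _]|[xT [z1 /andP[z21 z2N] z3] _ _]]; first by split.
  by split => //; split => //; rewrite z2N andbT; lra.
have Inv0 : Inv (y 0 0%N) 0 0%N.
  have adm0 := admE _ y0; split => //.
    move=> q _; have [_ h] := energy_bounds M0 MP q epsP adm0.
    rewrite mulr0 expR0 mul1r /e0; have : 0 <= res * eps by rewrite mulr_ge0// ltW.
    lra.
  by case: adm0 => _ [_ /andP[_ h] _]; rewrite !addr0.
have Inv_flow a b i : Inv (y a i) a i -> 0 <= a -> a <= b ->
    `[a, b]%classic `<=` time_slice E i -> Inv (y b i) b i.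
  (* A degenerate interval involves no flow; otherwise its midpoint is interior to the time slice,
     as the flow clause of a solution requires. *)
  move=> IH a0; rewrite le_eqVlt => /predU1P[<-//|ab] abE.
  have [|yac yC yae] := yflow i.
    exists ((a + b) / 2); apply/nbhs_ballP; exists ((b - a) / 2) => /=.
      by rewrite divr_gt0// subr_gt0.
    move=> x; rewrite /ball/= ltr_distlC => /andP[h1 h2].
    by apply: abE; rewrite /= in_itv/=; apply/andP; split; lra.
  have abac := yac _ _ (ltW ab) abE.
  have yadm u : a <= u <= b -> admissible (y u i).
    by move=> uab; apply: admE; left; apply: yC; apply: abE; rewrite /= in_itv.
  have yd : {ae lebesgue_measure, forall t : R, a < t < b ->
     exists2 v, osc_flow_map w kappa G mode eta2 eta1 eps (y t i) v &
                is_derive t (1 : R) (fun s => y s i) v}.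
    apply: ae_imply yae => u + uab; apply; apply: abE.
    by rewrite /= in_itv/=; case/andP: uab => h1 h2; rewrite !ltW.
  have [adma Ea za] := IH; split.
  - by apply: yadm; rewrite lexx ltW.
  - move=> q; rewrite (arc_z1 abac yd); last by rewrite lexx ltW.
    move=> zq; have Eaq := Ea q zq.
    have ea1 : energy w kappa G mode M eps q (y a i) < 1.
      have : expR (- c * a) * e0 <= e0.
        by rewrite ler_piMl// -expR0 ler_expR mulNr oppr_le0 mulr_ge0// ltW.
      lra.
    have re1 : res * eps < 1 by lra.
    apply: le_trans (arc_energy w_gt0 w_inj kappa_gt0 c0 cP M0 MP
      eta1P epsP (ltW ab) abac yadm yd zq ea1 re1) _.
    have -> : - c * b = - c * (b - a) + - c * a by ring.
    by rewrite expRD -mulrA ler_wpM2l ?expR_ge0.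
  - have := arc_z2 eta1P (ltW ab) abac yd; lra.
have Inv_jump a i : Inv (y a i) a i -> E (a, i) -> E (a, i.+1) ->
    Inv (y a i.+1) a i.+1.
  move=> [adma Ea za] Eai Eai1; have [] := yjump _ _ Eai Eai1.
  move: (y a i) (y a i.+1) adma Ea za.
  move=> [[x [[z1 z2] z3]] t12] [[x' [[z1' z2'] z3']] t12'] adma Ea za [_ Ds _ _].
  move=> /= [x'E [[z1'm _] [z2'E z3'E]] _].
  have [xT [/= z1m /andP[z20 z2N] z3P]] := adma.
  have [_ /andP[/= z21 _] _] := Ds.
  split.
  - split; rewrite /= ?x'E ?z3'E//; split => //=.
    by rewrite z2'E; apply/andP; split; lra.
  - move=> q' _; have [q _ qE] := z1m.
    apply: le_trans (Ea q (esym qE)); rewrite lerD2r.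
    by apply: (jump_energy MP) => //; rewrite /st_x /st_z2/= ?x'E ?z2'E.
  - by move: za; rewrite /st_z2/= z2'E -natr1; lra.
(* Truncated at [(t, j)], the domain has finitely many switching times [tt]. The invariant is
   carried to the start of the [j]-th interval by induction, then along it up to [t]. *)
have [J [tt [tt0 tt_mono EJ]]] := Edom _ Etj.
have inE s i : (i < J)%N -> tt i <= s <= tt i.+1 -> E (s, i).
  by move=> iJ si; have [] : (E `&` [set q | 0 <= q.1 <= t /\ (q.2 <= j)%N]) (s, i)
    by rewrite EJ.
have [jJ /andP[ttj jtt]] : (j < J)%N /\ tt j <= t <= tt j.+1.
  have : [set p | (p.2 < J)%N /\ tt p.2 <= p.1 <= tt p.2.+1] (t, j).
    by rewrite -EJ; split => //; split => //=; rewrite lexx (E_ge0 _ Etj).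
  by [].
have tt_ge0 i : (i <= J)%N -> 0 <= tt i.
  elim: i => [|i IH] iJ; first by rewrite tt0.
  by apply: le_trans (tt_mono _ iJ); apply: IH; exact: ltnW.
have InvJ i : (i <= j)%N -> Inv (y (tt i) i) (tt i) i.
  elim: i => [|i IH] ij; first by rewrite tt0.
  have iJ : (i < J)%N by exact: leq_trans ij (ltnW jJ).
  have i1J : (i.+1 < J)%N by exact: leq_ltn_trans ij jJ.
  apply: Inv_jump.
  - apply: (Inv_flow (tt i)); [exact/IH/ltnW|exact/tt_ge0/ltnW|exact: tt_mono|].
    by move=> u /=; rewrite in_itv/=; exact: inE.
  - by apply: inE => //; rewrite lexx tt_mono.
  - by apply: inE => //; rewrite lexx tt_mono.
have [adm Et zt] : Inv (y t j) t j.
  apply: (Inv_flow (tt j)); [exact: InvJ|exact/tt_ge0/ltnW|exact: ttj|].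
  move=> u /=; rewrite in_itv/= => /andP[u1 u2]; apply: inE => //.
  by rewrite u1 (le_trans u2).
have [_ [[q _ qE] /andP[z20 _] _]] := adm.
have hE := Et q (esym qE); have [hV _] := energy_bounds M0 MP q epsP adm.
have t0 : 0 <= t := E_ge0 _ Etj.
have e1 : expR (- c * t) <= 1.
  by rewrite -expR0 ler_expR mulNr oppr_le0 mulr_ge0// ltW.
have h3 : expR (- c * t) * ((2 * M + 2 * M * N0) * eps) <= (2 * M + 2 * M * N0) * eps.
  by rewrite ler_piMl// mulr_ge0// ltW.
split => //.
  move: hE; rewrite /e0 (mulrDl _ res) mulrDr; lra.
by split => //; move: zt; rewrite /st_z2; lra.
Qed.

End HybridArc.

(** * Class KL bounds for proper indicators *)

Section SequentialCompactness.
Variables (R : realType) (W : normedModType R).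
Implicit Types (p : nat -> W) (b : W).

(** Clustering of the sequence, spelled out so that limits of inequalities follow without extracting
    subsequences. *)
Definition cluster_point p b := forall N (O : set W), nbhs b O ->
  exists2 n, (N <= n)%N & O (p n).

Lemma compact_cluster_point (K : set W) p : compact K -> (forall n, K (p n)) ->
  exists2 b, K b & cluster_point p b.
Proof.
move=> cK pK; have [|b [Kb bp]] := cK (p @ \oo) _.
  by exists 0%N => // n _; exact: pK.
exists b => // N O /(bp (p @` [set n | (N <= n)%N])) [|_ [[n Nn <-] On]].
  by exists N => // n /= Nn; exists n.
by exists n.
Qed.

Lemma cluster_point_dist (f : W -> R) p b (e : R) N : cluster_point p b ->
  {for b, continuous f} -> 0 < e -> exists2 n, (N <= n)%N & `|f (p n) - f b| < e.
Proof.
move=> pb fb e0; have /cvgrPdist_lt/(_ _ e0) := fb.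
by move=> /(pb N)[n Nn fn]; exists n => //; rewrite distrC.
Qed.

Lemma invS_small (e : R) : 0 < e -> exists N, forall n, (N <= n)%N -> n.+1%:R^-1 < e.
Proof.
move=> e0; have [N _ NP] := near_infty_natSinv_lt (PosNum e0).
by exists N => n Nn; exact: NP.
Qed.

Lemma cluster_point_le (f : W -> R) p b (d : R) : cluster_point p b ->
  {for b, continuous f} -> (forall n, f (p n) <= d + n.+1%:R^-1) -> f b <= d.
Proof.
move=> pb fb fp; apply/ler_addgt0Pr => e e0.
have e20 : 0 < e / 2 by rewrite divr_gt0.
have [N NP] := invS_small e20.
have [n Nn] := cluster_point_dist N pb fb e20.
rewrite ltr_distl => /andP[h1 h2]; move: (NP n Nn) (fp n) h1.
by move: (f (p n)) (n.+1%:R^-1) => u v *; lra.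
Qed.

Lemma cluster_point_ge (f : W -> R) p b (d : R) : cluster_point p b ->
  {for b, continuous f} -> (forall n, d - n.+1%:R^-1 <= f (p n)) -> d <= f b.
Proof.
move=> pb fb fp; rewrite -lerN2.
apply: (@cluster_point_le (fun x => - f x) p) => //.
  by apply: (@continuousN _ _ _ f).
by move=> n; move: (fp n); move: (n.+1%:R^-1) => v ?; lra.
Qed.

Lemma compact_lt1 (K : set W) (U : W -> R) : compact K -> continuous U ->
  (forall x, K x -> U x < 1) -> exists2 d, d < 1 & forall x, K x -> U x <= d.
Proof.
move=> cK cU KU; apply: contrapT => H.
have : forall n : nat, exists x, K x /\ 1 - n.+1%:R^-1 <= U x.
  move=> n; apply: contrapT => Hn; apply: H; exists (1 - n.+1%:R^-1).
    by rewrite gtrBl invr_gt0.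
  by move=> x Kx; rewrite leNgt; apply/negP => xU; apply: Hn; exists x; rewrite ltW.
move=> /choice[p pP].
have [b Kb pb] := compact_cluster_point cK (fun n => (pP n).1).
have := KU b Kb; rewrite ltNge => /negP; apply.
by apply: (cluster_point_ge pb (cU b)) => n; have [] := pP n.
Qed.

End SequentialCompactness.

Section KLBound.
Variables (R : realType) (W : normedModType R) (Mset : set W) (U omega : W -> R).
Hypotheses (cM : compact Mset) (cU : continuous U) (U_ge0 : forall x, 0 <= U x).
Let B := [set x | U x < 1].
Let A := Mset `&` [set x | U x = 0].
Hypotheses (A_neq0 : A !=set0) (om : proper_indicator A B omega).
Implicit Types (p : nat -> W) (x b : W).

Lemma open_sublevel : open B.
Proof.
by apply: (open_comp (D := [set y : R | y < 1])) => //; exact: open_lt.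
Qed.

Lemma omega_continuous b : B b -> {for b, continuous omega}.
Proof.
move=> Bb; have [+ _ _ _] := om.
by rewrite continuous_open_subspace//; [apply; rewrite inE|exact: open_sublevel].
Qed.

Let omega_ge0 x : B x -> 0 <= omega x.
Proof. by have [_ + _ _] := om; apply. Qed.

Let omega_A x : A x -> omega x = 0.
Proof.
move=> Ax; have [_ _ /(_ x) H _] := om; apply H => //.
by rewrite /B/=; case: Ax => _ /= ->.
Qed.

(** A cluster point outside [B] would be a boundary point approached by a subsequence, along which a
    proper indicator must be unbounded. *)
Lemma cluster_point_basin p b (a : R) : (forall n, B (p n)) ->
  (forall n, omega (p n) <= a) -> cluster_point p b -> B b.
Proof.
move=> pB pa pb; apply: contrapT => nBb.
have : forall n, exists m, `|p m - b| < n.+1%:R^-1.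
  move=> n; have n0 : 0 < n.+1%:R^-1 :> R by rewrite invr_gt0.
  have [m _ mP] := pb 0%N _ (nbhsx_ballx b _ n0).
  by exists m; move: mP; rewrite -ball_normE/= distrC.
move=> /choice[m mP].
have [_ _ _ /(_ (p \o m))] := om; apply => //.
- by move=> n; exact: pB.
- left => e e0; have [N NP] := invS_small e0.
  exists N => // n /= Nn; exists b; last exact: lt_trans (mP n) (NP n Nn).
  split; last by move/interior_subset.
  by move=> O /(pb 0%N)[k _ Ok]; exists (p k).
- exists a; split => [|M aM _ [n _ <-]]; first exact: num_real.
  rewrite /= ger0_norm; last by apply: omega_ge0; exact: pB.
  exact: le_trans (pa _) (ltW aM).
Qed.

(** Counterexamples for smaller and smaller [rho] would cluster in [Mset] at a zero of [U], that is
    in [A], where [omega] is continuous and vanishes. *)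
Lemma omega_small (e : R) : 0 < e -> exists2 rho : R, 0 < rho < 1 &
  forall x, Mset x -> U x <= rho -> omega x <= e.
Proof.
move=> e0; apply: contrapT => H.
(* The shift by two keeps the candidate [rho] strictly below 1. *)
have : forall n : nat, exists x, [/\ Mset x, U x <= n.+2%:R^-1 & e < omega x].
  move=> n; apply: contrapT => Hn; apply: H; exists n.+2%:R^-1.
    by rewrite invr_gt0 ltr0n/= invf_lt1// ltr1n.
  move=> x Mx xU; rewrite leNgt; apply/negP => ex; apply: Hn; by exists x.
move=> /choice[p pP].
have [b Mb pb] := compact_cluster_point cM (fun n => let: And3 h _ _ := pP n in h).
have Ub : U b = 0.
  apply/le_anti; rewrite U_ge0 andbT; apply: (cluster_point_le pb (@cU b)) => n.
  have [_ h _] := pP n; apply: (le_trans h); rewrite add0r lef_pV2 ?posrE//.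
  by rewrite ler_nat.
have Bb : B b by rewrite /B/= Ub.
have [n _] := cluster_point_dist 0 pb (omega_continuous Bb) e0.
rewrite (omega_A (conj Mb Ub)) subr0 => /(le_lt_trans (ler_norm _)).
by have [_ _ h] := pP n; rewrite ltNge ltW.
Qed.

(** The converse comparison; here [cluster_point_basin] is what keeps the cluster point of
    counterexamples inside [B]. *)
Lemma small_of_omega_small (rho : R) : 0 < rho -> exists2 a : R, 0 < a &
  forall x, Mset x -> B x -> omega x <= a -> U x <= rho.
Proof.
move=> rho0; apply: contrapT => H.
have : forall n : nat, exists x,
    [/\ Mset x, B x, omega x <= n.+1%:R^-1 & rho < U x].
  move=> n; apply: contrapT => Hn; apply: H; exists n.+1%:R^-1.
    by rewrite invr_gt0.
  move=> x Mx Bx xo; rewrite leNgt; apply/negP => ex; apply: Hn; by exists x.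
move=> /choice[p pP].
have pB n : B (p n) by have [] := pP n.
have [b Mb pb] := compact_cluster_point cM (fun n => let: And4 h _ _ _ := pP n in h).
have Bb : B b.
  apply: (cluster_point_basin (a := 1) pB) pb => n; have [_ _ h _] := pP n.
  by apply: le_trans h _; rewrite invf_le1// ler1n.
have ob : omega b <= 0.
  apply: (cluster_point_le pb (omega_continuous Bb)) => n.
  by rewrite add0r; have [] := pP n.
have ob0 : omega b = 0 by apply/le_anti; rewrite ob omega_ge0.
have [_ Ub] : A b by have [_ _ /(_ _ Bb)[h _] _] := om; exact: h.
have : rho <= U b.
  apply: (cluster_point_ge pb (@cU b)) => n; have [_ _ _ h] := pP n.
  apply: le_trans (ltW h); by rewrite gerBl invr_ge0.
by rewrite Ub leNgt rho0.
Qed.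

Lemma omega_le_away_boundary (a : R) : exists2 d : R, d < 1 &
  forall x, Mset x -> B x -> omega x <= a -> U x <= d.
Proof.
apply: contrapT => H.
have : forall n : nat, exists x,
    [/\ Mset x, B x, omega x <= a & 1 - n.+1%:R^-1 <= U x].
  move=> n; apply: contrapT => Hn; apply: H; exists (1 - n.+1%:R^-1).
    by rewrite gtrBl invr_gt0.
  move=> x Mx Bx xo; rewrite leNgt; apply/negP => ex; apply: Hn; exists x.
  by split => //; exact: ltW.
move=> /choice[p pP].
have [b Mb pb] := compact_cluster_point cM (fun n => let: And4 h _ _ _ := pP n in h).
have : B b by apply: (cluster_point_basin (a := a)) pb => n; have [] := pP n.
rewrite /B/= ltNge => /negP; apply.
by apply: (cluster_point_ge pb (@cU b)) => n; have [] := pP n.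
Qed.

Lemma omega_bounded (d : R) : d < 1 -> exists b : R,
  forall x, Mset x -> U x <= d -> omega x <= b.
Proof.
move=> d1; apply: contrapT => H.
have : forall n : nat, exists x, [/\ Mset x, U x <= d & n%:R < omega x].
  move=> n; apply: contrapT => Hn; apply: H; exists n%:R.
  move=> x Mx xU; rewrite leNgt; apply/negP => ex; apply: Hn; by exists x.
move=> /choice[p pP].
have [b Mb pb] := compact_cluster_point cM (fun n => let: And3 h _ _ := pP n in h).
have Ub : U b <= d.
  apply: (cluster_point_le pb (@cU b)) => n; have [_ h _] := pP n.
  by apply: le_trans h _; rewrite lerDl.
have Bb : B b by exact: le_lt_trans d1.
pose N := Num.Def.truncn (omega b + 1).
have [n Nn] := cluster_point_dist N.+1 pb (omega_continuous Bb) ltr01.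
rewrite ltr_distl => /andP[_ h1]; have [_ _ h2] := pP n.
have : omega b + 1 < N.+1%:R.
  exact: truncnS_gt.
have : N.+1%:R <= n%:R :> R by rewrite ler_nat.
lra.
Qed.

Variables (c N0 : R).
Hypothesis c_gt0 : 0 < c.

(** [g v = 1 - (1 - v) ^+ 2] vanishes at 0, stays below 1 for [v < 1] and exceeds [v] by
    [v * (1 - v)]: a margin that absorbs perturbations. *)
Let g (v : R) := v * (2 - v).
(** The decay in [t] expressed in hybrid time: since at most [N0 + t] jumps occur, [s = t + j]
    satisfies [s - N0 <= 2 * t]. *)
Let h (s : R) := expR (- (c / 2) * (s - N0)).

(** The constraint with [h] yields decay as [s] grows. The one with [g] yields smallness as [a]
    tends to 0 and keeps [x] away from the boundary of the basin, so that the supremum is finite. *)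
Definition KL_set (a s : R) : set R := [set omega x | x in [set x |
  [/\ Mset x, U x <= h s &
   exists x0, [/\ Mset x0, B x0, omega x0 <= a & U x <= g (U x0)]]]].

Definition KL_bound (a s : R) : R := sup (KL_set a s).

Let KL_set_neq0 a s : 0 <= a -> KL_set a s !=set0.
Proof.
move=> a0; have [x Ax] := A_neq0; have [Mx /= Ux] := Ax; exists (omega x), x => //.
split => //; first by rewrite Ux expR_ge0.
exists x; split => //; first by rewrite /B/= Ux.
  by rewrite omega_A.
by rewrite Ux /g mul0r.
Qed.

Let g_lt1 v d : v <= d -> d < 1 -> g v <= 1 - (1 - d) ^+ 2 /\ g v < 1.
Proof. by move=> vd d1; split; rewrite /g; nra. Qed.

Let KL_set_bounded a : exists m : R, forall s, ubound (KL_set a s) m.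
Proof.
have [d d1 dP] := omega_le_away_boundary a.
have [b bP] := @omega_bounded (1 - (1 - d) ^+ 2) ltac:(nra).
exists b => s _ [x [Mx _ [x0 [Mx0 Bx0 x0a xg]]] <-]; apply: bP => //.
by apply: le_trans xg _; have [] := g_lt1 (dP _ Mx0 Bx0 x0a) d1.
Qed.

Let KL_has_sup a s : 0 <= a -> has_sup (KL_set a s).
Proof.
by move=> a0; split; [exact: KL_set_neq0|have [b /(_ s)] := KL_set_bounded a; exists b].
Qed.

Let KL_set_ge0 a s o : KL_set a s o -> 0 <= o.
Proof.
move=> [x [Mx _ [x0 [Mx0 Bx0 x0a xg]]] <-]; apply: omega_ge0.
apply: le_lt_trans xg _; move: Bx0; rewrite /B/= /g => Bx0; nra.
Qed.

Lemma KL_bound_ge0 a s : 0 <= a -> 0 <= KL_bound a s.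
Proof.
move=> a0; have [v Sv] := KL_set_neq0 s a0.
apply: le_trans (KL_set_ge0 Sv) _; apply: ub_le_sup => //.
by have [] := KL_has_sup s a0.
Qed.

Let KL_bound_le a a' s s' : 0 <= a -> KL_set a s `<=` KL_set a' s' -> 0 <= a' ->
  KL_bound a s <= KL_bound a' s'.
Proof.
move=> a0 SS a'0; apply: sup_le_ub; first exact: KL_set_neq0.
move=> o /SS So; apply: ub_le_sup => //.
by have [] := KL_has_sup s' a'0.
Qed.

Lemma class_KL_bound : class_KL KL_bound.
Proof.
split.
- by move=> a s a0 _; exact: KL_bound_ge0.
- move=> a b s a0 ab _; apply: KL_bound_le => //; last exact: le_trans ab.
  move=> o [x [Mx xh [x0 [Mx0 Bx0 x0a xg]]] <-]; exists x => //; split => //.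
  by exists x0; split => //; exact: le_trans ab.
- move=> a s t a0 s0 st; apply: KL_bound_le => //.
  move=> o [x [Mx xh X] <-]; exists x => //; split => //.
  apply: le_trans xh _; rewrite /h ler_expR !mulNr lerN2 ler_wpM2l//.
    by rewrite divr_ge0// ltW.
  by rewrite lerD2r.
- move=> s s0; apply/cvgrPdist_le => e e0.
  have [rho /andP[rho0 _] rhoP] := omega_small e0.
  (* Half of [rho], because [g v <= 2 * v]. *)
  have rho20 : 0 < rho / 2 by rewrite divr_gt0.
  have [a a0 aP] := small_of_omega_small rho20.
  near=> b; have b0 : 0 < b by near: b; exact: nbhs_right_gt.
  have ba : b <= a by near: b; exact: nbhs_right_le.
  have b1 := ltW b0; rewrite sub0r normrN ger0_norm ?KL_bound_ge0//.
  apply: sup_le_ub; first by apply: KL_set_neq0; exact: ltW.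
  move=> o [x [Mx xh [x0 [Mx0 Bx0 x0a xg]]] <-]; apply: rhoP => //.
  have := aP x0 Mx0 Bx0 (le_trans x0a ba); have := U_ge0 x0.
  by move: xg; rewrite /g; nra.
- move=> a a0; apply/cvgrPdist_le => e e0.
  have [rho /andP[rho0 _] rhoP] := omega_small e0.
  (* The time at which [h] takes the value [rho]. *)
  exists (N0 - 2 / c * ln rho); split => [|s sP]; first exact: num_real.
  rewrite sub0r normrN ger0_norm ?KL_bound_ge0//.
  apply: sup_le_ub; first exact: KL_set_neq0.
  move=> o [x [Mx xh _] <-]; apply: rhoP => //; apply: le_trans xh _.
  rewrite -[leRHS]lnK ?posrE// /h ler_expR.
  have -> : ln rho = - (c / 2) * (N0 - 2 / c * ln rho - N0).
    by field; rewrite gt_eqF.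
  rewrite !mulNr lerN2; apply: ler_wpM2l; first by rewrite divr_ge0// ltW.
  by rewrite lerD2r ltW.
Unshelve. all: by end_near. Qed.

(** Either [k] is small compared with the decayed initial value, and the margin of [g] absorbs it,
    so [omega x] belongs to [KL_set]; or that value is itself of the order of [k], and [omega x] is
    at most [nu]. *)
Lemma KL_bound_practical (K : set W) (nu : R) : compact K -> K `<=` B -> 0 < nu ->
  exists d C0 : R, [/\ 0 < C0, d + C0 < 1, (forall x, K x -> U x <= d) &
    forall x0 x (t s k : R), K x0 -> Mset x0 -> Mset x -> 0 <= t ->
      s <= N0 + 2 * t -> 0 <= k <= C0 ->
      U x <= expR (- c * t) * U x0 + k ->
      B x /\ omega x <= KL_bound (omega x0) s + nu].
Proof.
move=> cK KB nu0; have [d' d'1 d'P] := compact_lt1 cK cU KB.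
pose d := Num.max d' 0.
have d1 : d < 1 by rewrite gt_max d'1/=.
have d0 : 0 <= d by rewrite le_max lexx orbT.
have dP x : K x -> U x <= d.
  by move=> /d'P h0; apply: le_trans h0 _; rewrite le_max lexx.
have [rho /andP[rho0 rho1] rhoP] := omega_small nu0.
(* The first bound gives [d + C0 < 1]. The second serves the case where [k] is not absorbed, in
   which [U x * (1 - d) <= k * (2 - d)], so that [U x <= rho]. *)
pose C0 := Num.min ((1 - d) / 2) (rho * (1 - d) / (2 - d)).
have C00 : 0 < C0.
  rewrite lt_min; apply/andP; split; first by rewrite divr_gt0//; lra.
  by rewrite divr_gt0 ?mulr_gt0//; lra.
have C01 : C0 <= (1 - d) / 2 by rewrite ge_min lexx.
have C02 : C0 * (2 - d) <= rho * (1 - d).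
  by rewrite -ler_pdivlMr; [rewrite ge_min lexx orbT|lra].
exists d, C0; split => //; first lra.
move=> x0 x t s k Kx0 Mx0 Mx t0 st /andP[k0 kC] Ux.
have Ux0d := dP _ Kx0; have Ux00 := U_ge0 x0.
have ox0 : 0 <= omega x0 by apply: omega_ge0; exact: KB.
pose E := expR (- c * t).
have E0 : 0 <= E by exact: expR_ge0.
have E1 : E <= 1.
  by rewrite -expR0 /E ler_expR mulNr oppr_le0 mulr_ge0// ltW.
rewrite -/E in Ux.
have EU0 : 0 <= E * U x0 by rewrite mulr_ge0.
have [Ek|Ek] := leP k (E * U x0 * (1 - d)).
  have Uxg : U x <= E * g (U x0).
    have : 0 <= E * U x0 * (d - U x0) by rewrite mulr_ge0// subr_ge0.
    have -> : E * g (U x0) = E * U x0 + E * U x0 * (1 - d) + E * U x0 * (d - U x0).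
      by rewrite /g; ring.
    lra.
  have [_ g1] := g_lt1 Ux0d d1.
  have g0 : 0 <= g (U x0) by rewrite /g mulr_ge0//; lra.
  have Uxg' : U x <= g (U x0) by apply: le_trans Uxg _; rewrite ler_piMl.
  split; first exact: le_lt_trans g1.
  apply: (@le_trans _ _ (KL_bound (omega x0) s)); last by rewrite lerDl ltW.
  apply: ub_le_sup; first by have [] := KL_has_sup s ox0.
  exists x => //; split => //; last by exists x0; split => //; exact: KB.
  apply: le_trans Uxg _; apply: (@le_trans _ _ E).
    by rewrite ler_piMr// ltW.
  have cs : c / 2 * (s - N0) <= c / 2 * (2 * t).
    by apply: ler_wpM2l; [rewrite divr_ge0// ltW|lra].
  by rewrite /E /h ler_expR; lra.
have Uxr : U x <= rho.
  have h1 : U x * (1 - d) <= (E * U x0 + k) * (1 - d).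
    by rewrite ler_wpM2r//; lra.
  have h2 : k * (2 - d) <= C0 * (2 - d) by rewrite ler_wpM2r//; lra.
  have h3 : U x * (1 - d) <= rho * (1 - d) by lra.
  by move: h3; rewrite ler_pM2r//; lra.
split; first exact: le_lt_trans rho1.
by have := rhoP _ Mx Uxr; have := KL_bound_ge0 s ox0; lra.
Qed.

End KLBound.

(** * Compactness of the torus and of the clock set *)

Section Compactness.
Variables (R : realType) (r : nat).
Local Notation space := 'M[R]_(r, 2).

Lemma eval_continuous tau (e : term R r) :
  continuous (fun x : space => eval x tau e).
Proof.
elim: e => [i c|a|e1 IH1 e2 IH2|e1 IH1 e2 IH2|f IH|om e IH|om e IH] x;
  cbn [eval].
- exact: coord_continuous.
- exact: cst_continuous.
- exact: (continuousD (IH1 x) (IH2 x)).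
- exact: (continuousM (IH1 x) (IH2 x)).
- apply: (@continuous_big R 'I_r +%R 0 xpredT _ space (index_enum _)
    (fun i y => eval y tau (f i))) => [|i _]; last exact: IH.
  exact: add_continuous.
- apply: (continuous_comp (f := fun z => om * tau + eval z tau e) (g := @sin R)).
    apply: (@continuousD _ _ _ (cst (om * tau)) (fun z => eval z tau e)).
      exact: cst_continuous.
    exact: (IH x).
  exact: continuous_sin.
- apply: (continuous_comp (f := fun z => om * tau + eval z tau e) (g := @cos R)).
    apply: (@continuousD _ _ _ (cst (om * tau)) (fun z => eval z tau e)).
      exact: cst_continuous.
    exact: (IH x).
  exact: continuous_cos.
Qed.

Lemma disagreement_continuous : continuous (@disagreement R r).
Proof.
have -> : @disagreement R r = fun x => eval x 0 (disagreement_term R r).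
  by apply/funext => x; rewrite eval_disagreement.
exact: eval_continuous.
Qed.

Lemma vec_mx_continuous m n : continuous (@vec_mx R m n).
Proof.
move=> v A /nbhs_ballP[e /= e0 eA]; apply/nbhs_ballP; exists e => // u [_ uv].
by apply: eA; split => // i j; rewrite !mxE; exact: uv.
Qed.

Lemma compact_torus : compact (@torus R r).
Proof.
have tC : closed (@torus R r).
  have -> : @torus R r =
      \bigcap_(i in setT) [set x | euclid_sq (osc x i) = 1].
    by apply/seteqP; split => x xT i; [move=> _; exact: xT|exact: (xT i)].
  apply: closed_bigI => i _.
  have -> : [set x : space | euclid_sq (osc x i) = 1] =
      (fun x => eval x 0 (Add (Mul (Coord i 0) (Coord i 0)) (Mul (Coord i 1) (Coord i 1))))
      @^-1` [set y | y = 1].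
    by apply/seteqP; split => x /=; rewrite euclid_sq_osc.
  by apply: preimage_closed (@closed_eq R 1) => x _; exact: eval_continuous.
(* The Heine-Borel theorem is applied to row vectors and carried over to matrices. *)
have -> : @torus R r = @vec_mx R r 2 @` (@vec_mx R r 2 @^-1` (@torus R r)).
  apply/seteqP; split => [x xT|_ [v vT <-] //].
  by exists (mxvec x); rewrite /= mxvecK.
apply: continuous_compact; first by apply: continuous_subspaceT; exact: vec_mx_continuous.
apply: bounded_closed_compact.
  exists 1; split => // N N1 v /torus_unit_box vB; rewrite /mkset.
  rewrite [leLHS]/Num.norm/= mx_normrE; apply/bigmax_leP; split => [|[i j] _]; first lra.
  rewrite ord1 /=; case/mxvec_indexP: j => i' j'.
  by have := vB i' j'; rewrite mxE => /le_trans; apply; exact: ltW.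
by apply: preimage_closed tC => x _; exact: vec_mx_continuous.
Qed.

Lemma compact_Cz n (N0 T0 : R) : compact (Cz n N0 T0).
Proof.
have -> : Cz n N0 T0 = (@mode_set R n `*` `[0, N0]) `*` `[0, T0].
  apply/seteqP; split => [[[z1 z2] z3] [/= h1 h2 h3]|[[z1 z2] z3] [[/= h1 h2] h3]].
    by split; [split|] => //=; rewrite in_itv.
  by split.
apply: compact_setX; last exact: segment_compact.
apply: compact_setX; last exact: segment_compact.
by apply: finite_compact; apply: finite_image; exact: finite_finset.
Qed.

Lemma sync_setE : @sync_set R r = @torus R r `&` [set x | disagreement x = 0].
Proof.
apply/seteqP; split => x [xT xs]; split => //=.
  rewrite /disagreement big1 ?mulr0// => i _; rewrite big1// => j _.
  by rewrite /gap (xs i j) subrr /euclid_sq big1// => k _; rewrite mxE expr0n.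
move=> i j; have : gap x i j = 0.
  apply/le_anti; rewrite gap_ge0 andbT.
  by have := gap_le_disagreement x i j; rewrite xs mulr0.
rewrite /gap /euclid_sq => /psumr_eq0P H; apply/eqP; rewrite -subr_eq0.
apply/eqP/matrixP => k l; rewrite !ord1 [RHS]mxE.
by apply/eqP; rewrite -sqrf_eq0; apply/eqP; apply: H => // ? _; exact: sqr_ge0.
Qed.

End Compactness.

(** * Practical stability of the synchronized set *)

Theorem proposition1 (R : realType) (r N1 N2 : nat) (hr : (2 <= r)%N)
    (hN1 : (1 <= N1)%N) (hN2 : (1 <= N2)%N) (hN : (2 <= N1 * N2)%N)
    (J : {set {ffun 'I_r -> bool}}) (hJ : #|J| = N1)
    (G : 'I_N2 -> rel 'I_r)
    (G_undirected : forall k : 'I_N2, symmetric (G k))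
    (G_connected : forall (k : 'I_N2) (i j : 'I_r), connect (G k) i j)
    (mode : 'I_(N1 * N2) -> 'I_N2 * {ffun 'I_r -> bool})
    (mode_bij : set_bij [set: 'I_(N1 * N2)]
                  [set p : 'I_N2 * {ffun 'I_r -> bool} | p.2 \in J] mode)
    (w : 'I_r -> rat) (w_gt0 : forall i : 'I_r, 0 < w i)
    (w_neq : forall i j : 'I_r, i != j -> w i != w j)
    (kappa : R) (hkappa : 0 < kappa)
    (eta2 : R) (heta2 : 0 <= eta2 < 1)
    (N0 : R) (hN0 : 1 <= N0) (T0 : R) (hT0 : 0 < T0) :
  let A := @sync_set R r `*` Cz (N1 * N2) N0 T0 in
  exists B : set ('M[R]_(r, 2) * (R * R * R)),
    [/\ open B, A `<=` B &
        SGPAS (fun s : 'M[R]_(r, 2) * (R * R * R) * (R * R) => s.1)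
          (fun eta1 eps : R =>
             switched_oscillators (fun i => ratr (w i)) kappa G mode
               eta2 N0 T0 eta1 eps)
          A B].
Proof.
move=> A; pose n := (N1 * N2)%N.
pose W := (osc_space R r * aux_space R)%type.
pose U (p : W) := disagreement p.1.
pose Mset : set W := @torus R r `*` Cz n N0 T0.
have cU : continuous U.
  move=> p; apply: (continuous_comp (f := fst) (g := @disagreement R r)).
    exact: cvg_fst.
  exact: disagreement_continuous.
have cM : compact Mset by apply: compact_setX; [exact: compact_torus|exact: compact_Cz].
have U_ge0 p : 0 <= U p by exact: disagreement_ge0.
have AE : A = Mset `&` [set p | U p = 0].
  rewrite /A sync_setE; apply/seteqP; split => [p [[pT pU] pC]|p [[pT pC] pU]].
    by split.
  by split.
pose B := [set p | U p < 1].
have oB : open B by exact: open_sublevel.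
have AB : A `<=` B by rewrite AE => p [_ /= pU]; rewrite /B/= pU.
have A0 : A !=set0.
  have n0 : (0 < n)%N by exact: ltnW.
  exists (\matrix_(i, j) (j == 0)%:R, (mode_value R (Ordinal n0), 0, 0)); split.
    split => [i|i j]; last by apply/matrixP => k l; rewrite !mxE.
    by rewrite euclid_sq_osc /dot !mxE/= mulr1 mulr0 addr0.
  split; first by exists (Ordinal n0).
    by rewrite /= lexx (le_trans ler01).
  by rewrite /= lexx ltW.
pose w' i : R := ratr (w i).
have w'0 i : 0 < w' i by rewrite ltr0q.
have w'inj : injective w'.
  move=> i j wij; apply/eqP; apply: contrapT => /negP /w_neq/eqP; apply.
  exact: (fmorph_inj (ratr : {rmorphism rat -> R})).
have [c [C [c0 C0 traj]]] := @trajectory_bound R r n N2 w' kappa G mode eta2 N0 T0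
  w'0 w'inj hkappa G_undirected G_connected (le_trans ler01 hN0).
exists B; split => //; split => //.
  rewrite AE; apply: compact_closedI => //.
  apply: (@preimage_closed W R U [set v | v = 0]); last exact: closed_eq.
  by move=> p _; exact: cU.
move=> omega om; rewrite AE in om A0.
exists (KL_bound Mset U omega c N0).
  exact: (class_KL_bound cM cU U_ge0 A0 om N0 c0).
move=> K cK KB nu nu0.
have [d [C1 [C10 dC1 dP KP]]] :=
  KL_bound_practical cM cU U_ge0 A0 om N0 c0 cK KB nu0.
(* Any clock rate up to 1 is slow enough for the jump count, whatever [K] and [nu]. *)
exists 1 => // eta1 eta1P.
(* Ensures [eps <= 1] and [C * eps <= C1]; adding 1 avoids a zero denominator. *)
pose e1 := Num.min 1 (C1 / (C + 1)).
exists e1; first by rewrite lt_min ltr01/= divr_gt0//; lra.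
move=> eps /andP[eps0 epse] E y ysol Ky t j Etj.
have eps1 : eps <= 1 by apply: le_trans epse _; rewrite ge_min lexx.
have Ceps : C * eps <= C1.
  have : eps <= C1 / (C + 1) by apply: le_trans epse _; rewrite ge_min lexx orbT.
  rewrite ler_pdivlMr; last lra.
  lra.
have Ceps0 : 0 <= C * eps by rewrite mulr_ge0// ltW.
have V0 := dP _ Ky.
have epsP : 0 < eps <= 1 by rewrite eps0.
have Vlt : disagreement (st_x (y 0 0%N)) + C * eps < 1.
  by move: V0; rewrite /U /st_x; lra.
have [[xT zC] Vt [t0 jt]] := traj _ _ _ _ eta1P epsP ysol Vlt _ _ Etj.
have [_ E0 _ _ _] := ysol.
have [[xT0 zC0] _ _] := traj _ _ _ _ eta1P epsP ysol Vlt _ _ E0.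
apply: (KP _ _ t _ (C * eps)) => //.
- lra.
- by rewrite Ceps0.
Qed.
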